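(* Let $\mathcal{A}$ be a finite set, let $(f_w)_{w\in\mathcal{A}}$ be similitudes $f_w:[0,1]\to[0,1]$, $f_w(x)=r_wx+b_w$, with $r_w\in(0,1)$ and $b_w\in[0,1]$, and let $F\subset[0,1]$ be the self-similar set associated with them, i.e. the non-empty compact set with $F=\bigcup_{w\in\mathcal{A}}f_w(F)$. Suppose the images $(f_w([0,1]))_{w\in\mathcal{A}}$ are pairwise disjoint except at the endpoints, and there exist $j,k\in\mathcal{A}$ and a real number $l\geq2$ such that $\log r_j/\log r_k$ is non-Liouville of degree $l$. Then there exists a self-similar probability measure $\mu_{\mathcal{A}}$ on $F$ (associated with the similitudes $(f_w)_{w\in\mathcal{A}}$) such that, as $\xi\to\pm\infty$, $$\widehat{\mu_{\mathcal{A}}}(\xi)=O\left((\log|\xi|)^{-\dim F/(2(1+2\dim F)(8l-7))}\right),$$ where $\dim F$ denotes the Hausdorff dimension of $F$.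
   Context: $\mathbb{N}=\{1,2,3,\ldots\}$. ''Pairwise disjoint except at the endpoints'' means that for distinct $w,w'\in\mathcal{A}$ the closed intervals $f_w([0,1])$ and $f_{w'}([0,1])$ intersect at most in endpoints, i.e. their interiors are disjoint. Self-similar measure: a Borel probability measure $\mu$ is self-similar, associated with the similitudes $(f_w)_{w\in\mathcal{A}}$, if $\mu=\sum_{w\in\mathcal{A}}p_w\,\mu\circ f_w^{-1}$ for some weights $(p_w)_{w\in\mathcal{A}}$ with $p_w>0$ for all $w\in\mathcal A$ and $\sum_{w\in\mathcal{A}}p_w=1$. Fourier transform: for a probability measure $\mu$ on $F\subset[0,1]$ and $\xi\in\mathbb{R}$, $\widehat{\mu}(\xi)=\int_F e^{-2\pi i\xi x}\,\mu(\mathrm{d}x)$. Non-Liouville: for $l>0$, a real number $\theta$ is non-Liouville of degree $l$ if there exists $c>0$ such that $|\theta-p/q|\geq c/q^l$ for all $p\in\mathbb{Z}$ and $q\in\mathbb{N}$. *)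

(* Defs.v *)
From HB Require Import structures.
From mathcomp Require Import all_boot all_order all_algebra.
From mathcomp Require Import complex.
From mathcomp Require Import all_classical all_reals all_analysis.
Set Implicit Arguments.
Unset Strict Implicit.
Unset Printing Implicit Defensive.
Import Order.TTheory GRing.Theory Num.Theory.
Import numFieldNormedType.Exports.
Local Open Scope classical_set_scope.
Local Open Scope ring_scope.

(* For A = set0 this is -oo; [hausdorff_weight] treats that case apart. *)
Definition diam (R : realType) (A : set R) : \bar R :=
  ereal_sup [set `|xy.1 - xy.2|%:E | xy in A `*` A].

(* diam(A)^s, with the usual conventions that the empty set has weight 0 for
   every s, and that 0^0 = 1 (so that the 0-dimensional measure counts
   points). *)
Definition hausdorff_weight (R : realType) (s : R) (A : set R) : \bar R :=
  if A == set0 then 0%E else (diam A `^ s)%E.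

Definition hausdorff_content (R : realType) (s delta : R) (A : set R) : \bar R :=
  ereal_inf [set (\sum_(i <oo) hausdorff_weight s (U i))%E |
    U in [set U : (set R)^nat |
      A `<=` \bigcup_i U i /\ forall i, (diam (U i) <= delta%:E)%E]].

(* The content is nonincreasing in delta, so the limit as delta -> 0+ is the
   supremum over delta > 0. *)
Definition hausdorff_measure (R : realType) (s : R) (A : set R) : \bar R :=
  ereal_sup [set hausdorff_content s delta A | delta in [set d : R | 0 < d]].

(* The infimum is over a nonempty set of nonnegative reals, because every
   A : set R has zero s-dimensional measure for s > 1; hence [fine] never
   meets an infinite value here. *)
Definition hausdorff_dim (R : realType) (A : set R) : R :=
  fine (ereal_inf
    [set s%:E | s in [set s : R | 0 <= s /\ hausdorff_measure s A = 0%E]]).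

Definition non_liouville (R : realType) (l theta : R) : Prop :=
  exists2 c : R, 0 < c &
    forall (p : int) (q : nat), (0 < q)%N ->
      c / (q%:R `^ l) <= `|theta - p%:~R / q%:R|.

Definition similitude (R : realType) (r b x : R) : R := r * x + b.

Definition self_similar_set (R : realType) (A : finType) (f : A -> R -> R)
    (F : set R) : Prop :=
  [/\ F `<=` `[0, 1], F !=set0, compact F &
      F = \bigcup_(w in [set: A]) (f w @` F)].

(* [pushforward mu (f w) B] is mu (f_w^{-1} B).  The preimage is taken in R;
   for mu concentrated on a subset of [0, 1] this agrees with the preimage in
   [0, 1]. *)
Definition self_similar_measure (R : realType) (A : finType) (f : A -> R -> R)
    (mu : probability (measurableTypeR R) R) : Prop :=
  exists p : A -> R,
    [/\ forall w, 0 < p w, \sum_w p w = 1 &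
        forall B : set (measurableTypeR R), measurable B ->
          mu B = (\sum_w (p w)%:E *
            pushforward mu (f w : measurableTypeR R -> measurableTypeR R) B)%E].

(* The integral over F of exp(-2 pi i xi x), in real and imaginary parts. *)
Definition fourier (R : realType) (F : set R)
    (mu : probability (measurableTypeR R) R) (xi : R) : R[i] :=
  ((\int[mu]_(x in F) cos (2 * pi * xi * x))
   -i* (\int[mu]_(x in F) sin (2 * pi * xi * x)))%C.

(* Let the Landau notations be used at +oo and -oo. *)
Canonical pinfty_filter_on (R : realType) :=
  FilterType (pinfty_nbhs R) (@filter_filter _ _ proper_pinfty_nbhs).
Canonical ninfty_filter_on (R : realType) :=
  FilterType (ninfty_nbhs R) (@filter_filter _ _ proper_ninfty_nbhs).

(* Main.v *)
(* Weight f_w by p_w = r_w ^ s, where sum_w p_w = 1 (hence dim F <= s), and let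
   e(u) be the squared modulus of the Fourier transform of the self-similar
   measure at u / (2 pi).  By self-similarity and convexity
   e(u) <= sum_w p_w e(r_w u), so along the random walk with steps - ln r_w the
   value e(exp L) is at most the integral of e(exp (L - .)) over a window
   [t, t + M], against the occupation measure of the walk.  By Fejer's kernel,
   the mass that this measure gives to short cells is controlled by sums of
   geometric series in the characteristic function of a step, which stays
   polynomially away from 1 because log r_j / log r_k is non-Liouville.  Hence
   e(exp L) is O(1 + ln L) times a mean of e over frequencies up to a small power
   of L, and such means decay by the Hoelder bound mu(B(x, rho)) = O(rho ^ s).
   Optimizing the parameters gives e(exp L) = O((1 + ln L) L ^ (- a)) with
   a = s / ((1 + 2 s) (4 l - 4)); as 4 l - 4 < 8 l - 7 and dim F <= s, the
   logarithm is absorbed in the announced rate. *)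

Require Import Defs.
From HB Require Import structures.
From mathcomp Require Import all_boot all_order all_algebra.
From mathcomp Require Import complex.
From mathcomp Require Import all_classical all_reals all_analysis.
From mathcomp Require Import measurable_realfun.
From mathcomp Require Import zify ring lra.
Set Implicit Arguments.
Unset Strict Implicit.
Unset Printing Implicit Defensive.
Import Order.TTheory GRing.Theory Num.Theory.
Import numFieldNormedType.Exports.
Local Open Scope classical_set_scope.
Local Open Scope ring_scope.

(** * The natural self-similar measure *)

(** A renewal theorem would say that the walk fills the window evenly; here an upper bound for the
    mass of each cell is enough, and it may lose a logarithm. The logarithm comes from low
    frequencies theta, where the characteristic function is near 1 and its geometric series is
    merely O(1 / theta): over multiples of 1 / L this is a harmonic sum. At higher frequencies, up
    to Theta, the Diophantine condition keeps one of two sines above a multiple of Theta ^ (1 - l),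
    and the loss of modulus is quadratic in that sine, of order Theta ^ (- 2 (l - 1)). The walk
    takes of order L steps to reach the window, so Theta = L ^ (1 / (4 (l - 1))) leaves a loss L ^
    (- 1/2) per step and a total factor exp (- const * sqrt L), which beats every power of L. This
    Theta is the resolution of the cells and the source of 4 l - 4. Since e is a squared modulus, a
    square root halves its exponent at the end; and u / (1 + 2 u) increases with u, so dim F <= s
    passes to the exponents. *)

Section SelfSimilarCdf.
Context (R : realType) (A : finType) (r b p : A -> R).
Hypothesis r_gt0 : forall w, 0 < r w.
Hypothesis b_ge0 : forall w, 0 <= b w.
Hypothesis br_le1 : forall w, b w + r w <= 1.
Hypothesis p_ge0 : forall w, 0 <= p w.
Hypothesis p_sum1 : \sum_w p w = 1.

Definition cdf_step (G : R -> R) (x : R) : R :=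
  \sum_w p w * G ((x - b w) / r w).

(* Starting from the cdf of the Dirac mass at 1 makes the iterates increase. *)
Definition cdf_iter (n : nat) : R -> R :=
  iter n cdf_step (fun x => (1 <= x)%R%:R).

Definition ss_cdf (x : R) : R := lim (cdf_iter n x @[n --> \oo]).

Lemma cdf_step_le G H : (forall x, G x <= H x) ->
  forall x, cdf_step G x <= cdf_step H x.
Proof. by move=> GH x; apply: ler_sum => w _; rewrite ler_wpM2l. Qed.

Lemma cdf_iter_ge1 n x : 1 <= x -> cdf_iter n x = 1.
Proof.
elim: n x => [|n IH] x x1; first by rewrite /= x1.
rewrite /cdf_iter iterS -/(cdf_iter n) /cdf_step.
under eq_bigr => w _.
  rewrite IH ?mulr1; last first.
    rewrite ler_pdivlMr // mul1r lerBrDr addrC (le_trans (br_le1 w)) //.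
  over.
exact: p_sum1.
Qed.

Lemma cdf_iter_lt0 n x : x < 0 -> cdf_iter n x = 0.
Proof.
elim: n x => [|n IH] x x0; first by rewrite /= leNgt (lt_trans x0).
rewrite /cdf_iter iterS -/(cdf_iter n) /cdf_step big1 // => w _.
rewrite IH ?mulr0 // pmulr_llt0 ?invr_gt0 // subr_lt0.
exact: lt_le_trans (b_ge0 w).
Qed.

Lemma cdf_iter_mono n : {homo cdf_iter n : x y / x <= y}.
Proof.
elim: n => [|n IH] x y xy /=.
  by case: (leP 1 x) => [x1|_]; [rewrite (le_trans x1 xy)|case: (1 <= y)].
apply: ler_sum => w _; rewrite ler_wpM2l // IH //.
by rewrite ler_wpM2r ?lerD2r // invr_ge0 ltW.
Qed.

Lemma cdf_iter_nd x : {homo (cdf_iter ^~ x) : m n / (m <= n)%N >-> m <= n}.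
Proof.
apply/nondecreasing_seqP => n; elim: n x => [|n IH] x.
  case: (leP 1 x) => [x1|]; first by rewrite !cdf_iter_ge1.
  rewrite ltNge /= => /negbTE ->; apply: sumr_ge0 => w _.
  by rewrite mulr_ge0.
exact: cdf_step_le.
Qed.

Lemma cdf_iter_le1 n x : cdf_iter n x <= 1.
Proof.
case: (leP 1 x) => [x1|x1]; first by rewrite cdf_iter_ge1.
by rewrite -(cdf_iter_ge1 n (lexx 1)) cdf_iter_mono // ltW.
Qed.

Lemma cdf_iter_cvg x : cdf_iter n x @[n --> \oo] --> ss_cdf x.
Proof.
apply: (@nondecreasing_is_cvgn R (cdf_iter ^~ x)).
  exact: cdf_iter_nd.
by exists 1 => _ [n _ <-]; exact: cdf_iter_le1.
Qed.

Lemma ss_cdfE x : ss_cdf x = \sum_w p w * ss_cdf ((x - b w) / r w).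
Proof.
have h : cdf_iter n.+1 x @[n --> \oo] -->
    \sum_w p w * ss_cdf ((x - b w) / r w).
  rewrite /cdf_iter /= /cdf_step; apply: cvg_big => //=.
    exact: add_continuous.
  by move=> w _; apply: cvgZr; exact: cdf_iter_cvg.
have := cdf_iter_cvg (x := x); rewrite -cvg_shiftS => h2.
exact: cvg_unique h2 h.
Qed.

Lemma ss_cdf_ge1 x : 1 <= x -> ss_cdf x = 1.
Proof.
move=> x1; apply: cvg_lim => //.
under eq_fun do rewrite cdf_iter_ge1 //.
exact: cvg_cst.
Qed.

Lemma ss_cdf_lt0 x : x < 0 -> ss_cdf x = 0.
Proof.
move=> x1; apply: cvg_lim => //.
under eq_fun do rewrite cdf_iter_lt0 //.
exact: cvg_cst.
Qed.

Lemma ss_cdf_nd : {homo ss_cdf : x y / x <= y}.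
Proof.
move=> x y xy; apply: (ler_cvg_to (cdf_iter_cvg (x := x)) (cdf_iter_cvg (x := y))).
by apply: nearW => n; exact: cdf_iter_mono.
Qed.

Lemma ss_cdf_le1 x : ss_cdf x <= 1.
Proof.
case: (leP 1 x) => [x1|x1]; first by rewrite ss_cdf_ge1.
by rewrite -(ss_cdf_ge1 (lexx 1)) ss_cdf_nd // ltW.
Qed.

Lemma ss_cdf_ge0 x : 0 <= ss_cdf x.
Proof.
case: (leP 0 x) => [x1|x1]; last by rewrite ss_cdf_lt0.
by rewrite -(@ss_cdf_lt0 (-1)) ?ss_cdf_nd ?oppr_lt0 //; lra.
Qed.

End SelfSimilarCdf.

(** The length of the intersection of [[u, v]] with [[0, 1]]. *)
Definition overlap01 (R : realType) (u v : R) : R :=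
  Num.max 0 (Num.min v 1 - Num.max u 0).

Lemma lebesgue_itvoo (R : realType) (u v : R) :
  lebesgue_measure `]u, v[%classic = (Num.max 0 (v - u))%:E.
Proof.
rewrite lebesgue_measure_itv /= lte_fin; case: ltP => uv.
  by rewrite -EFinB max_r // subr_ge0 ltW.
by rewrite max_l // subr_le0.
Qed.

Lemma sum_setTE (R : realType) (A : finType) (f : A -> \bar R) :
  (\sum_(w \in [set: A]) f w = \sum_w f w)%E.
Proof.
rewrite (fsbig_seq _ _ (index_enum_uniq A)).
apply: eq_fsbigl; apply/seteqP; split => w //= _.
exact: mem_index_enum.
Qed.

(** * Hoelder continuity of the distribution function *)

Section Frostman.
Context (R : realType) (A : finType) (r b : A -> R).
Hypothesis r_gt0 : forall w, 0 < r w.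
Hypothesis b_ge0 : forall w, 0 <= b w.
Hypothesis br_le1 : forall w, b w + r w <= 1.
Hypothesis disj : forall w w', w != w' ->
  `]b w, b w + r w[%classic `&` `]b w', b w' + r w'[%classic = set0.

Lemma scale_overlap01 w u v :
  r w * overlap01 ((u - b w) / r w) ((v - b w) / r w) =
  Num.max 0 (Num.min v (b w + r w) - Num.max u (b w)).
Proof.
have r0 := ltW (r_gt0 w); have rn0 := lt0r_neq0 (r_gt0 w).
rewrite /overlap01 maxr_pMr // mulr0 mulrBr minr_pMr // maxr_pMr // mulr0 mulr1.
rewrite ![r w * (_ / r w)]mulrC !divfK //.
congr Num.max.
have -> : Num.min (v - b w) (r w) = Num.min v (b w + r w) - b w.
  by rewrite addr_minl; congr Num.min; lra.
have -> : Num.max (u - b w) 0 = Num.max u (b w) - b w.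
  by rewrite addr_maxl; congr Num.max; lra.
lra.
Qed.

(** By scaling, each summand is the length of the part of []u, v[] inside f_w(]0, 1[). These parts
    are disjoint and lie in []0, 1[], so additivity of Lebesgue measure bounds their total
    length. *)
Lemma sum_overlap01 u v :
  \sum_w r w * overlap01 ((u - b w) / r w) ((v - b w) / r w) <=
  overlap01 u v.
Proof.
under eq_bigr do rewrite scale_overlap01.
rewrite -lee_fin -sumEFin.
pose I w : set R := `]Num.max u (b w), Num.min v (b w + r w)[%classic.
have mI w : measurable (I w) by exact: measurable_itv.
rewrite [X in (X <= _)%E](_ : _ = lebesgue_measure (\bigcup_(w in [set: A]) I w)).
  rewrite -lebesgue_itvoo; apply: le_measure; rewrite ?inE //.
    by apply: fin_bigcup_measurable => [|w _]; [exact: finite_finset|exact: mI].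
  move=> x [w _]; rewrite /I /= !in_itv /=.
  rewrite gt_max lt_min gt_max lt_min => /andP[/andP[-> bx] /andP[-> xb]] /=.
  by rewrite (le_lt_trans (b_ge0 w) bx) (lt_le_trans xb (br_le1 w)).
rewrite measure_fin_bigcup //=.
- by rewrite sum_setTE; apply: eq_bigr => w _; rewrite lebesgue_itvoo.
- apply/trivIsetP => w w' _ _ ww'; apply/seteqP; split => // x [].
  rewrite /I /= !in_itv /= !gt_max !lt_min.
  move=> /andP[/andP[_ h1] /andP[_ h2]] /andP[/andP[_ h3] /andP[_ h4]].
  have := disj ww'; rewrite -subset0 => /(_ x); apply.
  by rewrite /= !in_itv /= h1 h2 h3 h4.
- by move=> w _; exact: mI.
Qed.


Lemma overlap01_le (u v : R) : u <= v -> overlap01 u v <= v - u.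
Proof.
move=> uv; rewrite /overlap01 ge_max subr_ge0 uv /=.
by rewrite lerB // ?ge_min ?lexx // le_max lexx.
Qed.

Lemma overlap01_full (u v : R) : u <= 0 -> 1 <= v -> overlap01 u v = 1.
Proof.
move=> u0 v1; rewrite /overlap01 min_r // (max_r (y := 0)) // subr0 max_r //.
Qed.

Lemma overlap01_ge0 (u v : R) : 0 <= overlap01 u v.
Proof. by rewrite /overlap01 le_max lexx. Qed.

Variables (s rm rM : R) (G : R -> R).
Hypothesis s_ge0 : 0 <= s.
Hypothesis rm_gt0 : 0 < rm.
Hypothesis rm_le1 : rm <= 1.
Hypothesis rM_lt1 : rM < 1.
Hypothesis rM_gt0 : 0 < rM.
Hypothesis rmP : forall w, rm <= r w.
Hypothesis rMP : forall w, r w <= rM.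
Hypothesis G_ss : forall x, G x = \sum_w r w `^ s * G ((x - b w) / r w).
Hypothesis G_lt0 : forall x, x < 0 -> G x = 0.
Hypothesis G_ge1 : forall x, 1 <= x -> G x = 1.
Hypothesis G_ge0 : forall x, 0 <= G x.
Hypothesis G_le1 : forall x, G x <= 1.

(* Comparing with the length of a neighbourhood costs no constant at each step
   of the induction: that length is superadditive under the f_w, whose images
   do not overlap. *)
Lemma frostman_scale n rho u v : rM ^+ n <= rho -> rho <= rm^-1 -> u <= v ->
  G v - G u <= rm^-1 * rho `^ (s - 1) * overlap01 (u - rho) (v + rho).
Proof.
elim: n rho u v => [|n IH] rho u v rMn rho_le uv.
  rewrite expr0 in rMn; have rho0 : 0 < rho by lra.
  have c0 : 0 <= rm^-1 * rho `^ (s - 1).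
    by rewrite mulr_ge0 ?powR_ge0 // invr_ge0 ltW.
  have [v0|v0] := ltP v 0.
    by rewrite !G_lt0 ?(le_lt_trans uv) // subrr mulr_ge0 ?overlap01_ge0.
  have [u1|u1] := leP 1 u.
    by rewrite !G_ge1 ?(le_trans u1) // subrr mulr_ge0 ?overlap01_ge0.
  rewrite overlap01_full ?mulr1; [|lra|lra].
  apply: (@le_trans _ _ 1); first by have := G_le1 v; have := G_ge0 u; lra.
  (* The constant [rm^-1] originates here: for 1 <= rho <= [rm^-1] the power rho ^ (s - 1) can drop
     to 1 / rho, hence to [rm]. *)
  rewrite mulrC -ler_pdivrMr ?invr_gt0 // invrK mul1r.
  apply: (@le_trans _ _ (rho `^ (- 1))).
    by rewrite powR_inv1 ?(ltW rho0) // -(invrK rm) lef_pV2 ?posrE ?invr_gt0.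
  by rewrite ler_powR // -[leLHS]add0r lerD2r.
(* Only radii below 1 are rescaled, so [rho / r w] never exceeds [rm^-1]; the others descend to the
   base case unchanged. *)
have [rho1|rho1] := leP 1 rho.
  apply: (IH) => //; apply: le_trans rho1.
  by rewrite exprn_ile1 // ltW.
have rho0 : 0 < rho.
  by apply: lt_le_trans rMn; rewrite exprn_gt0.
rewrite (G_ss v) (G_ss u) -sumrB.
apply: (@le_trans _ _ (\sum_w rm^-1 * rho `^ (s - 1) *
   (r w * overlap01 ((u - rho - b w) / r w) ((v + rho - b w) / r w)))).
  apply: ler_sum => w _; rewrite -mulrBr.
  have rw0 := r_gt0 w; have rn0 := lt0r_neq0 rw0.
  have := IH (rho / r w) ((u - b w) / r w) ((v - b w) / r w).
  have -> : (u - b w) / r w - rho / r w = (u - rho - b w) / r w by field.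
  have -> : (v - b w) / r w + rho / r w = (v + rho - b w) / r w by field.
  set V := overlap01 _ _ => h.
  (* The weight r_w ^ s turns (rho / r_w) ^ (s - 1) back into rho ^ (s - 1) and leaves one factor
     r_w, which is the one that [sum_overlap01] consumes. *)
  have -> : rm^-1 * rho `^ (s - 1) * (r w * V) =
      r w `^ s * (rm^-1 * (rho / r w) `^ (s - 1) * V).
    have -> : r w `^ s = r w * r w `^ (s - 1).
      rewrite -{2}(powRr1 (ltW rw0)) -powRD; first by congr powR; lra.
      by rewrite rn0 implybT.
    have -> : rho `^ (s - 1) = (rho / r w) `^ (s - 1) * r w `^ (s - 1).
      by rewrite -powRM ?divfK // ?ltW // divr_gt0.
    by ring.
  rewrite ler_wpM2l ?powR_ge0 //; apply: h.
  - rewrite ler_pdivlMr //; apply: le_trans rMn.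
    by rewrite exprSr ler_wpM2l // exprn_ge0 // ltW.
  - rewrite ler_pdivrMr //; apply: (le_trans (ltW rho1)).
    by rewrite mulrC ler_pdivlMr // mul1r.
  - by rewrite ler_wpM2r ?invr_ge0 ?lerD2r // ltW.
rewrite -mulr_sumr ler_wpM2l ?sum_overlap01 //.
by rewrite mulr_ge0 ?powR_ge0 // invr_ge0 ltW.
Qed.

(** [frostman_scale] at the scale rho = v - u: the enlarged interval has length 3 rho, and rho ^ (s
    - 1) * rho = rho ^ s. For rho above [rm^-1] the right side already exceeds 1. *)
Lemma ss_holder u v : u <= v -> G v - G u <= 3 * rm^-1 * (v - u) `^ s.
Proof.
have c0 : 0 <= 3 * rm^-1 by rewrite mulr_ge0 // invr_ge0 ltW.
rewrite le_eqVlt => /predU1P[->|uv].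
  by rewrite subrr mulr_ge0 // powR_ge0.
set rho := v - u.
have rho0 : 0 < rho by rewrite subr_gt0.
have [rl|rl] := leP rho rm^-1; last first.
  apply: (@le_trans _ _ 1); first by have := G_le1 v; have := G_ge0 u; lra.
  have rm1 : 1 <= rm^-1 by rewrite invf_ge1.
  have : 1 <= rho `^ s by rewrite -(powRr0 rho) ler_powR //; lra.
  by nra.
have [n rMn] : exists n, rM ^+ n <= rho.
  have : (rM ^+ n) @[n --> \oo] --> (0 : R).
    by apply: cvg_expr; rewrite ger0_norm // ltW.
  move/cvgrPdist_lt => /(_ _ rho0) [n _ /(_ n (leqnn n))] /=.
  by rewrite sub0r normrN ger0_norm ?exprn_ge0 // 1?ltW // => /ltW; exists n.
apply: (le_trans (frostman_scale rMn rl (ltW uv))).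
have -> : 3 * rm^-1 * rho `^ s = rm^-1 * rho `^ (s - 1) * (3 * rho).
  have -> : rho `^ s = rho * rho `^ (s - 1); last by ring.
  rewrite -{2}(powRr1 (ltW rho0)) -powRD; first by congr powR; lra.
  by rewrite lt0r_neq0 // implybT.
rewrite ler_wpM2l //; first by rewrite mulr_ge0 ?powR_ge0 // invr_ge0 ltW.
apply: le_trans (overlap01_le _) _; rewrite /rho; lra.
Qed.

End Frostman.

(** * From the distribution function to the measure, and its concentration on F *)

Lemma stieltjes_probability (R : realType) (G : R -> R) :
  {homo G : x y / x <= y} -> continuous G ->
  (forall x, x < 0 -> G x = 0) -> (forall x, 1 <= x -> G x = 1) ->
  exists mu : probability (measurableTypeR R) R,
    (forall a b, a <= b -> mu `]a, b]%classic = (G b - G a)%:E) /\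
    (forall nu : {measure set (measurableTypeR R) -> \bar R},
      (forall a b, a <= b -> nu `]a, b]%classic = (G b - G a)%:E) ->
      forall B, measurable B -> mu B = nu B).
Proof.
move=> G_nd G_cont G_lt0 G_ge1.
have rcG := right_continuousW G_cont.
have GNy : G @ -oo --> (0 : R).
  apply/cvgrPdist_le => e e0; near=> x.
  by rewrite G_lt0 ?subrr ?normr0 ?ltW //; near: x; exact: nbhs_ninfty_lt.
have Gy : G @ +oo --> (1 : R).
  apply/cvgrPdist_le => e e0; near=> x.
  by rewrite G_ge1 ?subrr ?normr0 ?ltW //; near: x; exact: nbhs_pinfty_ge.
pose m1 := isCumulative.Build R _ R G G_nd rcG.
pose m2 := isCumulativeBounded.Build R 0 1 G GNy Gy.
pose f : cumulativeBounded (0 : R) (1 : R) := HB.pack G m1 m2.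
have muE a b : a <= b -> lebesgue_stieltjes_measure f `]a, b]%classic = (G b - G a)%:E.
  move=> ab; rewrite /lebesgue_stieltjes_measure /measure_extension.
  by rewrite measurable_mu_extE /= ?wlength_itv_bnd //; exact: is_ocitv.
exists (lebesgue_stieltjes_measure f); split => // nu nuE B mB.
apply: lebesgue_stieltjes_measure_unique => // _ [[a b]] _ <- /=.
have [ab|ba] := leP a b; first by rewrite nuE // muE.
by rewrite set_itv_ge ?measure0 // -leNgt bnd_simp ltW.
Unshelve. all: by end_near. Qed.

(** Having the mixture as a genuine measure lets uniqueness on half-open intervals apply to it, and
    lets self-similarity pass from sets to integrals. *)
Lemma sum_pushforward_measure (R : realType) (I : Type) (s : seq I) (p : I -> R)
    (f : I -> measurableTypeR R -> measurableTypeR R)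
    (mu : {measure set (measurableTypeR R) -> \bar R}) :
  (forall i, 0 <= p i) -> (forall i, measurable_fun setT (f i)) ->
  exists nu : {measure set (measurableTypeR R) -> \bar R},
    (forall B, nu B = (\sum_(i <- s) (p i)%:E * pushforward mu (f i) B)%E) /\
    (forall g : measurableTypeR R -> \bar R, measurable_fun setT g ->
      (forall x, 0 <= g x)%E ->
      (\int[nu]_x g x = \sum_(i <- s) (p i)%:E * \int[mu]_x g (f i x))%E).
Proof.
move=> p0 mf; elim: s => [|i s [nu [nuE nuI]]].
  exists mzero; split=> [B|g mg g0]; first by rewrite big_nil.
  by rewrite big_nil integral_measure_zero.
pose pf : {measure set (measurableTypeR R) -> \bar R} :=
  measure_function_pushforward__canonical__measure_function_Measure mu (mf i).
exists (measure_add (mscale (NngNum (p0 i)) pf) nu); split=> [B|g mg g0].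
  by rewrite big_cons -nuE; exact: measure_addE.
rewrite big_cons -nuI // ge0_integral_measure_add // ge0_integral_mscale //.
by rewrite ge0_integral_pushforward //.
Qed.

Lemma holder_continuous (R : realType) (G : R -> R) (c s : R) : 0 < s ->
  (forall u v, u <= v -> `|G v - G u| <= c * (v - u) `^ s) -> continuous G.
Proof.
move=> s0 H x; apply/cvgrPdist_le => e e0.
have c1 : 0 < `|c| + 1 by rewrite ltr_pwDr.
have d0 : 0 < (e / (`|c| + 1)) `^ s^-1 by rewrite powR_gt0 // divr_gt0.
have dist u v : u <= v -> v - u <= (e / (`|c| + 1)) `^ s^-1 -> `|G v - G u| <= e.
  move=> uv vu; apply: (le_trans (H _ _ uv)).
  have : (v - u) `^ s <= e / (`|c| + 1).
    have <- : ((e / (`|c| + 1)) `^ s^-1) `^ s = e / (`|c| + 1).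
      by rewrite -powRrM mulVf ?lt0r_neq0 // powRr1 // ltW // divr_gt0.
    by rewrite ge0_ler_powR ?nnegrE ?powR_ge0 ?subr_ge0 // ltW.
  rewrite ler_pdivlMr // => h; apply: le_trans h; rewrite mulrC.
  by rewrite ler_wpM2l ?powR_ge0 // (le_trans (ler_norm c)) // lerDl.
near=> y.
have xy : `|x - y| <= (e / (`|c| + 1)) `^ s^-1.
  by near: y; apply: (@cvgr_dist_le _ _ _ _ _ id).
have [h|h] := leP x y.
  by rewrite distrC dist // -(ger0_norm (x := y - x)) ?subr_ge0 // distrC.
by rewrite dist ?(ltW h) // -(ger0_norm (x := x - y)) // subr_ge0 ltW.
Unshelve. all: by end_near. Qed.

Lemma preimage_similitude_itv (R : realType) (r b u v : R) : 0 < r ->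
  similitude r b @^-1` `]u, v]%classic = `](u - b) / r, (v - b) / r]%classic.
Proof.
move=> r0; apply/seteqP; split => x; rewrite /similitude /= !in_itv /=;
  by rewrite ltr_pdivrMr // ler_pdivlMr // ltrBlDr lerBrDr mulrC.
Qed.

Lemma measurable_similitude (R : realType) (r b : R) :
  measurable_fun setT (similitude r b : measurableTypeR R -> measurableTypeR R).
Proof.
apply: measurable_funD; last exact: measurable_cst.
by apply: measurable_funM; [exact: measurable_cst|exact: measurable_id].
Qed.

Section NaturalMeasure.
Context (R : realType) (A : finType) (r b : A -> R) (s rm rM : R).
Hypothesis s_gt0 : 0 < s.
Hypothesis rm_gt0 : 0 < rm.
Hypothesis rM_lt1 : rM < 1.
Hypothesis rmP : forall w, rm <= r w.
Hypothesis rMP : forall w, r w <= rM.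
Hypothesis rm_rM : rm <= rM.
Hypothesis b_ge0 : forall w, 0 <= b w.
Hypothesis br_le1 : forall w, b w + r w <= 1.
Hypothesis disj : forall w w', w != w' ->
  `]b w, b w + r w[%classic `&` `]b w', b w' + r w'[%classic = set0.
Hypothesis moran : \sum_w r w `^ s = 1.

Lemma natural_measure :
  exists mu : probability (measurableTypeR R) R,
  [/\ forall B : set (measurableTypeR R), measurable B ->
          mu B = (\sum_w (r w `^ s)%:E *
            pushforward mu (similitude (r w) (b w) :
              measurableTypeR R -> measurableTypeR R) B)%E,
      mu (`[0, 1]%classic : set R) = 1%E &
      exists2 c : R, 0 < c & forall x rho : R, 0 < rho ->
        (mu `[(x - rho)%R, (x + rho)%R]%classic <= (c * rho `^ s)%:E)%E].
Proof.
have r_gt0 w : 0 < r w by apply: lt_le_trans (rmP w).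
have r_lt1 w : r w < 1 by apply: le_lt_trans (rMP w) _.
have p_ge0 w : 0 <= r w `^ s by exact: powR_ge0.
pose G := ss_cdf r b (fun w => r w `^ s).
have G_ss : forall x, G x = \sum_w r w `^ s * G ((x - b w) / r w).
  by move=> x; apply: ss_cdfE.
have G_lt0 : forall x, x < 0 -> G x = 0 by move=> x; apply: ss_cdf_lt0.
have G_ge1 : forall x, 1 <= x -> G x = 1 by move=> x; apply: ss_cdf_ge1.
have G_ge0 : forall x, 0 <= G x by move=> x; apply: ss_cdf_ge0.
have G_le1 : forall x, G x <= 1 by move=> x; apply: ss_cdf_le1.
have G_nd : {homo G : x y / x <= y} by move=> x y; apply: ss_cdf_nd.
have G_holder : forall u v, u <= v -> G v - G u <= 3 * rm^-1 * (v - u) `^ s.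
  move=> u v; apply: (ss_holder r_gt0 b_ge0 br_le1 disj (rM := rM)) => //.
  - exact: ltW.
  - by apply: (le_trans rm_rM); exact: ltW.
  - exact: lt_le_trans rm_rM.
clearbody G.
have G_cont : continuous G.
  apply: (holder_continuous s_gt0 (c := 3 * rm^-1)) => u v uv.
  by rewrite ger0_norm ?G_holder // subr_ge0 G_nd.
have [mu [muE muU]] := stieltjes_probability G_nd G_cont G_lt0 G_ge1.
have mu_le (X Y : set (measurableTypeR R)) :
    measurable X -> measurable Y -> X `<=` Y -> (mu X <= mu Y)%E.
  by move=> mX mY; apply: le_measure; rewrite inE.
exists mu; split.
- have [nu [nuE _]] := sum_pushforward_measure (index_enum A) mu p_ge0
    (fun w => @measurable_similitude R (r w) (b w)).
  (* By uniqueness, self-similarity is checked on half-open intervals, where it is the functional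
     equation of G. *)
  move=> B mB; rewrite -nuE; apply: muU => // u v uv; rewrite nuE.
  rewrite (G_ss v) (G_ss u) -sumrB -sumEFin; apply: eq_bigr => w _.
  rewrite -mulrBr EFinM; congr (_ * _)%E.
  rewrite /pushforward preimage_similitude_itv //; apply: muE.
  by rewrite ler_wpM2r ?invr_ge0 ?lerD2r // ltW.
- apply/eqP; rewrite eq_le; apply/andP; split.
    by apply: probability_le1; exact: measurable_itv.
  apply: (@le_trans _ _ (mu (`]0, 1]%classic : set R))).
    (* G vanishes on the negative axis, so continuity forces G 0 = 0: the measure has no atom at
       0. *)
    rewrite muE // G_ge1 // (_ : G 0 = 0) ?subr0 //.
    apply/eqP; rewrite eq_le G_ge0 andbT.
    apply: (cvgr_to_le (cvg_at_left_filter (G_cont 0))).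
    by near=> x; rewrite G_lt0.
  apply: mu_le; [exact: measurable_itv|exact: measurable_itv|].
  by move=> x /=; rewrite !in_itv /= => /andP[/ltW -> ->].
- exists (3 * rm^-1 * 3 `^ s) => [|x rho rho0].
    by rewrite !mulr_gt0 ?invr_gt0 // powR_gt0.
  (* A half-open interval that contains the closed ball, of length 3 rho; hence the factor 3 ^ s. *)
  apply: (@le_trans _ _ (mu `]x - 2 * rho, x + rho]%classic)).
    apply: mu_le; [exact: measurable_itv|exact: measurable_itv|].
    move=> y; rewrite /= !in_itv /= => /andP[h ->]; rewrite andbT.
    by apply: lt_le_trans h; lra.
  rewrite muE; last lra.
  rewrite lee_fin; apply: le_trans (G_holder _ _ _) _; first lra.
  rewrite -(mulrA (3 * rm^-1)) -powRM ?(ltW rho0) //.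
  by have -> : x + rho - (x - 2 * rho) = 3 * rho by ring.
Unshelve. all: by end_near. Qed.
End NaturalMeasure.

(** [D e] collects the points of [[0, 1]] at distance at least e from F. As f_w maps F into F, the
    part of f_w^-1([D e]) in [[0, 1]] lies in [D (e / r w)]. Iterating self-similarity pushes the
    distance above 1, where [D] is empty, so every [D e] with e > 0 is null. F being closed, these
    sets exhaust [[0, 1]] minus F. *)
Lemma self_similar_measure_full (R : realType) (A : finType) (r b p : A -> R)
    (rM : R) (F : set R) (mu : probability (measurableTypeR R) R) :
  (forall w, 0 < r w) -> (forall w, r w <= rM) -> rM < 1 -> 0 < rM ->
  self_similar_set (fun w => similitude (r w) (b w)) F ->
  (forall B : set (measurableTypeR R), measurable B ->
     mu B = (\sum_w (p w)%:E *
       pushforward mu (similitude (r w) (b w) :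
         measurableTypeR R -> measurableTypeR R) B)%E) ->
  mu (`[0, 1]%classic : set R) = 1%E -> mu F = 1%E.
Proof.
move=> r_gt0 rMP rM1 rM0 [F01 F0 Fc FE] mu_ss mu01.
have Fcl : closed F by apply: compact_closed.
pose I : set (measurableTypeR R) := (`[0, 1]%classic : set R).
have mI : measurable I by exact: measurable_itv.
have muIC : mu (~` I) = 0%E.
  by rewrite probability_setC // mu01 subee.
pose D (e : R) : set (measurableTypeR R) :=
  (`[0, 1]%classic `&` [set x | forall y, F y -> e <= `|x - y|] : set R).
have mD e : measurable (D e).
  apply: closed_measurable; apply: closedI; first exact: interval_closed.
  rewrite (_ : mkset _ = \bigcap_(y in F) ((fun x => `|x - y|) @^-1` [set z | e <= z])).
    apply: closed_bigI => y Fy; apply: preimage_closed; last exact: closed_ge.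
    move=> x _; apply: cvg_norm; apply: cvgB; [exact: cvg_id|exact: cvg_cst].
  by apply/seteqP; split => x /= h y Fy; apply: h.
have muD0 n e : rM ^+ n < e -> mu (D e) = 0%E.
  elim: n e => [|n IH] e en.
    rewrite (_ : D e = set0) ?measure0 //.
    rewrite -subset0 => x [x01 /= Dx].
    have [y Fy] := F0; have := Dx _ Fy; have := F01 _ Fy.
    rewrite /= !in_itv /= in x01 *; move: x01 => /andP[x0 x1] /andP[y0 y1].
    rewrite expr0 in en.
    have : `|x - y| <= 1 by rewrite ler_norml; lra.
    by lra.
  rewrite mu_ss // big1 // => w _; rewrite [X in (_ * X)%E](_ : _ = 0%E) ?mule0 //.
  rewrite /pushforward; apply/eqP; rewrite eq_le; apply/andP; split; last exact: measure_ge0.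
  have rw0 := r_gt0 w.
  have sub : similitude (r w) (b w) @^-1` D e `<=` D (e / r w) `|` ~` I.
    move=> x [/= fx01 Dfx].
    have [x01|x01] := pselect (I x); last by right.
    left; split => // y Fy.
    have Ffy : F (similitude (r w) (b w) y) by rewrite FE; exists w => //; exists y.
    have := Dfx _ Ffy; rewrite /similitude.
    have -> : r w * x + b w - (r w * y + b w) = r w * (x - y) by ring.
    by rewrite normrM gtr0_norm // ler_pdivrMr // mulrC.
  have mDU : measurable (D (e / r w) `|` ~` I).
    by apply: measurableU => //; exact: measurableC.
  have mpre : measurable (similitude (r w) (b w) @^-1` D e : set (measurableTypeR R)).
    rewrite -[X in measurable X]setTI; exact: measurable_similitude.
  have h : (mu (similitude (r w) (b w) @^-1` D e) <= mu (D (e / r w)%R `|` ~` I))%E.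
    by apply: le_measure; rewrite ?inE.
  apply: (le_trans h).
  have h2 : (mu (D (e / r w)%R `|` ~` I) <= mu (D (e / r w)%R) + mu (~` I))%E.
    by apply: measureU2 => //; exact: measurableC.
  apply: (le_trans h2).
  rewrite muIC adde0 IH // ltr_pdivlMr //; apply: le_lt_trans en.
  by rewrite exprSr ler_wpM2l // exprn_ge0 // ltW.
have muDz e : 0 < e -> mu (D e) = 0%E.
  move=> e0.
  have : (rM ^+ n) @[n --> \oo] --> (0 : R).
    by apply: cvg_expr; rewrite ger0_norm // ltW.
  move/cvgrPdist_lt => /(_ _ e0) [n _ /(_ n (leqnn n))] /=.
  by rewrite sub0r normrN ger0_norm ?exprn_ge0 // 1?ltW // => /muD0.
have mF : measurable (F : set (measurableTypeR R)) by exact: closed_measurable.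
suff : mu (~` F) = 0%E.
  by rewrite probability_setC // => /eqP; rewrite sube_eq ?fin_num_measure // add0e => /eqP <-.
apply/negligibleP; first exact: measurableC.
apply: (@negligibleS _ _ _ mu (~` I `|` \bigcup_n D (n.+1%:R^-1))); last first.
  apply: negligibleU; first by apply/negligibleP => //; exact: measurableC.
  apply: negligible_bigcup => n; apply/negligibleP => //.
  by apply: muDz; rewrite invr_gt0.
move=> x nFx; have [Ix|nIx] := pselect (I x); last by left.
right.
have : nbhs x (~` F).
  by apply: open_nbhs_nbhs; split => //; exact: closed_openC.
rewrite -nbhs_ballE => -[e /= e0 he].
have [n _ hn] : \forall n \near \oo, n.+1%:R^-1 < e by exact: near_infty_natSinv_lt (PosNum e0).
exists n => //; split => // y Fy /=.
apply: (le_trans (ltW (hn _ (leqnn n)))); rewrite leNgt; apply/negP => h.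
exact: (he y).
Qed.

(** * The dimension is at most the similarity dimension *)

Section HausdorffDimBound.
Context (R : realType) (A : finType) (r b : A -> R) (s rM : R) (F : set R).
Hypothesis r_gt0 : forall w, 0 < r w.
Hypothesis rMP : forall w, r w <= rM.
Hypothesis rM_lt1 : rM < 1.
Hypothesis rM_gt0 : 0 < rM.
Hypothesis F_ss : self_similar_set (fun w => similitude (r w) (b w)) F.
Hypothesis moran : \sum_w r w `^ s = 1.
Hypothesis s_ge0 : 0 <= s.

(* A pair (u, d) stands for the interval [u, u + d]. *)
Definition has_cover (t delta v : R) : Prop :=
  exists l : seq (R * R),
    [/\ forall x, F x -> exists2 i, i \in l & i.1 <= x <= i.1 + i.2,
        forall i, i \in l -> 0 <= i.2 <= delta &
        \sum_(i <- l) i.2 `^ t <= v].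

Lemma has_cover_unit t : has_cover t 1 1.
Proof.
case: F_ss => F01 _ _ _.
exists [:: (0, 1)]; split => [x /F01|i|].
- by rewrite /= in_itv /= => h; exists (0, 1); rewrite ?mem_head //= add0r.
- by rewrite inE => /eqP -> /=; rewrite ler01 lexx.
- by rewrite big_seq1 /= powR1.
Qed.

Lemma has_cover_step t delta v : 0 <= delta -> has_cover t delta v ->
  has_cover t (rM * delta) ((\sum_w r w `^ t) * v).
Proof.
case: F_ss => _ _ _ FE.
move=> delta0 [l [lF ld lv]].
exists [seq (r w * i.1 + b w, r w * i.2) | w <- index_enum A, i <- l]; split.
- move=> x; rewrite {1}FE => -[w _ [y /lF[i il /andP[h1 h2]] <-]].
  exists (r w * i.1 + b w, r w * i.2) => /=.
    by apply/allpairsP; exists (w, i); split => //=; exact: mem_index_enum.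
  rewrite /similitude lerD2r ler_pM2l // h1 /=.
  by rewrite addrAC lerD2r -mulrDr ler_pM2l.
- move=> _ /allpairsP[[w i] /= [_ il ->]] /=.
  have /andP[i0 id] := ld _ il.
  by rewrite mulr_ge0 ?(ltW (r_gt0 w)) //= ler_pM // ltW.
- rewrite big_allpairs_dep /= mulr_suml; apply: ler_sum => w _.
  rewrite big_seq_cond (eq_bigr (fun i : R * R => r w `^ t * i.2 `^ t)).
    by rewrite -big_seq_cond -mulr_sumr ler_wpM2l ?powR_ge0.
  move=> i; rewrite andbT => il; have /andP[i0 _] := ld _ il.
  by rewrite /= powRM // ltW.
Qed.

Lemma has_cover_iter t n : has_cover t (rM ^+ n) ((\sum_w r w `^ t) ^+ n).
Proof.
elim: n => [|n IH]; first exact: has_cover_unit.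
by rewrite !exprS; apply: has_cover_step => //; rewrite exprn_ge0 // ltW.
Qed.

Lemma diam_itv_le (u d : R) : 0 <= d -> (diam `[u, (u + d)%R]%classic <= d%:E)%E.
Proof.
move=> d0; apply: ge_ereal_sup => _ [[x y] [/= hx hy] <-].
rewrite /= !in_itv /= in hx hy; move: hx hy => /andP[h1 h2] /andP[h3 h4].
by rewrite lee_fin ler_norml; lra.
Qed.

Lemma diam_ge0 (B : set R) x : B x -> (0 <= diam B)%E.
Proof.
move=> Bx; apply: le_ereal_sup_tmp; exists 0%E => //.
by exists (x, x) => //=; rewrite subrr normr0.
Qed.

Lemma hausdorff_weight_ge0 t (B : set R) : (0 <= hausdorff_weight t B)%E.
Proof. by rewrite /hausdorff_weight; case: ifP => // _; exact: poweR_ge0. Qed.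

Lemma hausdorff_weight_itv t (u d : R) : 0 <= t -> 0 <= d ->
  (hausdorff_weight t `[u, (u + d)%R]%classic <= (d `^ t)%:E)%E.
Proof.
move=> t0 d0; rewrite /hausdorff_weight; case: ifP => _.
  by rewrite lee_fin powR_ge0.
rewrite -poweR_EFin gt0_ler_poweR ?in_itv //= ?leey ?andbT ?lee_fin //.
- by apply: (@diam_ge0 _ u); rewrite /= in_itv /= lexx lerDl.
- exact: diam_itv_le.
Qed.

Lemma hausdorff_content_le t delta eps v : 0 <= t -> has_cover t eps v ->
  0 <= eps -> eps <= delta -> (hausdorff_content t delta F <= v%:E)%E.
Proof.
move=> t0 [l [lF ld lv]] eps0 eps_le.
(* The finite cover is padded with empty sets, whose diameter is -oo and whose weight is 0. *)
pose U n : set R := if (n < size l)%N then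
  `[(nth (0, 0) l n).1, ((nth (0, 0) l n).1 + (nth (0, 0) l n).2)%R]%classic else set0.
apply: ge_ereal_inf; exists (\sum_(i <oo) hausdorff_weight t (U i))%E.
  exists U => //; split.
    move=> x /lF[i il hi]; exists (index i l) => //.
    by rewrite /U index_mem il nth_index //= in_itv.
  move=> n; rewrite /U; case: ifP => nl.
    have /andP[h1 h2] := ld _ (mem_nth (0, 0) nl).
    apply: (le_trans (diam_itv_le _ h1)).
    by rewrite lee_fin (le_trans h2).
  rewrite (_ : diam set0 = -oo%E) ?leNye //.
  by rewrite /diam set0X image_set0 ereal_sup0.
rewrite (@nneseries_split _ _ 0%N (size l)); last first.
  by move=> k _; exact: hausdorff_weight_ge0.
rewrite [X in (_ + X)%E]eseries0 ?adde0; last first.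
  move=> i; rewrite add0n => il _; rewrite /U ltnNge il /=.
  by rewrite /hausdorff_weight eqxx.
apply: le_trans (_ : _ <= (\sum_(i <- l) i.2 `^ t)%:E)%E _; last by rewrite lee_fin.
rewrite -sumEFin (big_nth (0, 0)) add0n big_seq_cond [leRHS]big_seq_cond.
apply: lee_sum => i; rewrite andbT mem_index_iota => /andP[_ il].
rewrite /U il; apply: hausdorff_weight_itv => //.
by have /andP[] := ld _ (mem_nth (0, 0) il).
Qed.

(** For t > s the sum of the r_w ^ t is below its value 1 at s, so the covers by n-fold images of
    [[0, 1]] have t-weight at most a geometric sequence tending to 0, while their mesh [rM ^+ n]
    tends to 0 too. *)
Lemma hausdorff_measure_eq0 t : s < t -> hausdorff_measure t F = 0%E.
Proof.
move=> st.
have kappa1 : \sum_w r w `^ t < 1.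
  rewrite -moran; case: F_ss => _ [x Fx] _ FE.
  have [w _ _] : exists2 w : A, True & True.
    by move: Fx; rewrite FE => -[w _ _]; exists w.
  apply: ltr_sum => [|v _]; first by apply/hasP; exists w => //; exact: mem_index_enum.
  by rewrite /powR gt_eqF // ltr_expR ltr_nM2r // ln_lt0 // r_gt0 /= (le_lt_trans (rMP v)).
have kappa0 : 0 <= \sum_w r w `^ t by apply: sumr_ge0 => w _; exact: powR_ge0.
apply/eqP; rewrite eq_le; apply/andP; split; last first.
  apply: le_ereal_sup_tmp; exists (hausdorff_content t 1 F); first by exists 1 => /=.
  apply: le_ereal_inf_tmp => _ [U _ <-]; apply: nneseries_ge0 => n _ _.
  exact: hausdorff_weight_ge0.
apply: ge_ereal_sup => _ [delta /= delta0 <-].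
apply/lee_addgt0Pr => e e0; rewrite add0e.
have lim0 (x : R) : 0 <= x < 1 -> (x ^+ n) @[n --> \oo] --> (0 : R).
  by move=> /andP[x0 x1]; apply: cvg_expr; rewrite ger0_norm.
have small (x y : R) : 0 <= x < 1 -> 0 < y -> \forall n \near \oo, x ^+ n <= y.
  move=> x01 y0; have /andP[x0 _] := x01.
  move/cvgrPdist_le: (lim0 _ x01) => /(_ _ y0).
  apply: filterS => n; by rewrite sub0r normrN ger0_norm // exprn_ge0.
have [n [h1 h2]] : exists n, rM ^+ n <= delta /\ (\sum_w r w `^ t) ^+ n <= e.
  have : \forall n \near \oo, rM ^+ n <= delta /\ (\sum_w r w `^ t) ^+ n <= e.
    near=> n; split; near: n; apply: small => //.
      by rewrite (ltW rM_gt0).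
    by rewrite kappa0.
  by move=> [n _ /(_ n (leqnn n))]; exists n.
apply: (@le_trans _ _ ((\sum_w r w `^ t) ^+ n)%:E); last by rewrite lee_fin.
apply: (hausdorff_content_le _ (has_cover_iter t n)) => //.
- by apply: (le_trans s_ge0); exact: ltW.
- by rewrite exprn_ge0 // ltW.
Unshelve. all: by end_near. Qed.

(** Every t > s competes in the infimum; the competitor s + 1 makes it finite, so that [fine]
    returns the true value. *)
Lemma hausdorff_dim_le : 0 <= hausdorff_dim F <= s.
Proof.
rewrite /hausdorff_dim; set I := ereal_inf _.
have I0 : (0 <= I)%E.
  by apply: le_ereal_inf_tmp => _ [t [t0 _] <-]; rewrite lee_fin.
have Is t : s < t -> (I <= t%:E)%E.
  move=> st; apply: ge_ereal_inf; exists t%:E => //; exists t => //=; split.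
    by apply: (le_trans s_ge0); exact: ltW.
  exact: hausdorff_measure_eq0.
have Ifin : I \is a fin_num.
  rewrite ge0_fin_numE //; apply: (le_lt_trans (Is (s + 1) _)); rewrite ?ltry //.
  by rewrite ltrDl.
rewrite fine_ge0 //=; apply/ler_addgt0Pr => e e0.
by rewrite -lee_fin fineK // Is // ltrDl.
Qed.

End HausdorffDimBound.

(** * The Fourier transform of a self-similar measure *)

Section TrigBounds.
Context (R : realType).
Implicit Types x y : R.

Lemma mvt_bound (f df : R -> R) (x y : R) :
  (forall z, is_derive z (1 : R) f (df z)) -> x <= y ->
  exists2 c, x <= c <= y & f y - f x = df c * (y - x).
Proof.
move=> fdf xy.
have [|c cxy ->] := MVT_segment xy (fun z _ => fdf z); last by exists c; rewrite ?(itvP cxy).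
apply: derivable_within_continuous => z _; exact: (@ex_derive _ _ _ _ _ _ _ (fdf z)).
Qed.

Lemma cos_lip x y : `|cos x - cos y| <= `|x - y|.
Proof.
wlog xy : x y / y <= x => [H|].
  have [/H //|/ltW /H] := leP y x.
  by rewrite distrC => h; rewrite (distrC x).
have [c _ ->] := mvt_bound (fun z => is_derive_cos z) xy.
by rewrite normrM ler_piMl // normrN sin_max.
Qed.

Lemma sin_lip x y : `|sin x - sin y| <= `|x - y|.
Proof.
wlog xy : x y / y <= x => [H|].
  have [/H //|/ltW /H] := leP y x.
  by rewrite distrC => h; rewrite (distrC x).
have [c _ ->] := mvt_bound (fun z => is_derive_sin z) xy.
by rewrite normrM ler_piMl // cos_max.
Qed.

Lemma abs_sin_le x : `|sin x| <= `|x|.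
Proof. by have := sin_lip x 0; rewrite sin0 !subr0. Qed.

Lemma cos_ge_half x : `|x| <= 1 -> 1 / 2 <= cos x.
Proof.
move=> x1; have -> : cos x = 1 - 2 * sin (x / 2) ^+ 2.
  rewrite {1}(_ : x = x / 2 + x / 2); last by field.
  by rewrite cosD -!expr2 cos2sin2; ring.
have := abs_sin_le (x / 2).
rewrite normrM (ger0_norm (x := 2^-1)) // => h.
have : `|sin (x / 2)| ^+ 2 <= (1 / 2) ^+ 2.
  by rewrite lerXn2r ?nnegrE //; lra.
by rewrite real_normK ?num_real //; lra.
Qed.

Lemma sin_ge_half x : 0 <= x <= 1 -> x / 2 <= sin x.
Proof.
move=> /andP[x0 x1].
have [c /andP[c0 cx]] := mvt_bound (fun z => is_derive_sin z) x0.
rewrite sin0 !subr0 => ->; rewrite mulrC ler_wpM2r //.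
by rewrite -(div1r 2) cos_ge_half // ger0_norm // (le_trans cx).
Qed.

Lemma sin_ge_quarter x : 0 <= x <= pi / 2 -> x / 4 <= sin x.
Proof.
move=> /andP[x0 x1]; have pi2 := @pihalf_lt2 R.
have [x1'|x1'] := leP x 1.
  by have := sin_ge_half (x := x); rewrite x0 x1' => /(_ isT); lra.
apply: (@le_trans _ _ (sin 1)).
  by have := sin_ge_half (x := 1); rewrite ler01 lexx => /(_ isT); lra.
have pi1 := @pihalf_ge1 R.
by apply/ltW; rewrite ltr_sin // in_itv /=; apply/andP; split; lra.
Qed.

Lemma abs_sin_shift x (p : int) : `|sin (x - p%:~R * pi)| = `|sin x|.
Proof.
have shift (n : nat) y : `|sin (y + n%:R * pi)| = `|sin y|.
  by rewrite mulr_natl (alternatingn (@sinDpi R)) normrM normrX normrN1 expr1n mul1r.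
case: p => n; first by rewrite -(shift n (x - _)) subrK.
by rewrite NegzE mulrNz mulNr opprK shift.
Qed.

Lemma near_pi_multiple x : exists p : int, `|x - p%:~R * pi| <= 4 * `|sin x|.
Proof.
have pi0 := @pi_gt0 R.
(* The integer nearest to x / pi: the remainder lies in [- pi / 2, pi / 2], where |y| <= 4 |sin
   y|. *)
exists (Num.floor (x / pi + 1 / 2)).
set p := Num.floor _.
have /andP[p1 p2] := Num.Theory.floor_itv (x / pi + 1 / 2).
rewrite -/p intrD in p1 p2.
have xE : x / pi * pi = x by rewrite divfK // lt0r_neq0.
have h1 : - (pi / 2) <= x - p%:~R * pi by nra.
have h2 : x - p%:~R * pi <= pi / 2 by nra.
have -> : `|sin x| = `|sin (x - p%:~R * pi)|.
  by rewrite abs_sin_shift.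
set y := x - _ in h1 h2 *.
wlog y0 : y h1 h2 / 0 <= y => [H|].
  have [/H|y0] := leP 0 y; first exact.
  by rewrite -normrN -(normrN (sin y)) -sinN; apply: H; lra.
rewrite !ger0_norm ?sin_ge0_pi //; [|by apply/andP; split; lra].
by have := sin_ge_quarter (x := y); rewrite y0 h2 => /(_ isT); lra.
Qed.

(** Multiplied by 2 sin (x / 2) >= x / 2, the sum telescopes to two sines. *)
Lemma dirichlet_bound (x : R) (N : nat) : 0 < x <= 1 ->
  `|\sum_(j < N) cos (j%:R * x)| <= 4 / x.
Proof.
move=> /andP[x0 x1].
have tele n : 2 * sin (x / 2) * \sum_(j < n) cos (j%:R * x) =
    sin (n%:R * x - x / 2) + sin (x / 2).
  elim: n => [|n IH]; first by rewrite big_ord0 mulr0 mul0r sub0r sinN; ring.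
  rewrite big_ord_recr /= mulrDr IH.
  have -> : n.+1%:R * x - x / 2 = n%:R * x + x / 2 by rewrite -natr1; field.
  by rewrite sinB sinD; ring.
have sx : x / 4 <= sin (x / 2).
  by have := sin_ge_half (x := x / 2); (have -> : 0 <= x / 2 <= 1 by apply/andP; split; lra) => /(_ isT); lra.
rewrite ler_pdivlMr //.
have : `|2 * sin (x / 2) * \sum_(j < N) cos (j%:R * x)| <= 2.
  rewrite tele (le_trans (ler_normD _ _)) //.
  by have := sin_max (N%:R * x - x / 2); have := sin_max (x / 2); lra.
rewrite normrM ger0_norm; last by lra.
have := normr_ge0 (\sum_(j < N) cos (j%:R * x)).
nra.
Qed.

End TrigBounds.

Section BoundedIntegrals.
Context (R : realType) (mu : probability (measurableTypeR R) R).
Implicit Types f g : R -> R.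

(** A class closed under the algebraic operations below and integrable for every probability
    measure: integrability conditions reduce to closure lemmas. *)
Definition bdd_measurable f : Prop :=
  measurable_fun (setT : set (measurableTypeR R)) (f : measurableTypeR R -> R) /\
  exists M, forall x, `|f x| <= M.

Lemma bdd_integrable f (D : set (measurableTypeR R)) : measurable D ->
  bdd_measurable f -> mu.-integrable D (EFin \o f).
Proof.
move=> mD [mf [M fM]]; apply: measurable_bounded_integrable => //.
- by rewrite (le_lt_trans (probability_le1 mu mD)) // ltry.
- exact: measurable_funS mf.
- exists M; split; first exact: num_real.
  by move=> x Mx y _; apply: (le_trans (fM y)); exact: ltW.
Qed.

Lemma bdd_cst c : bdd_measurable (fun=> c).
Proof. by split; [exact: measurable_cst|exists `|c|]. Qed.

Lemma bddD f g : bdd_measurable f -> bdd_measurable g ->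
  bdd_measurable (fun x => f x + g x).
Proof.
move=> [mf [M fM]] [mg [N gN]]; split; first exact: measurable_funD.
by exists (M + N) => x; rewrite (le_trans (ler_normD _ _)) // lerD.
Qed.

Lemma bddM f g : bdd_measurable f -> bdd_measurable g ->
  bdd_measurable (fun x => f x * g x).
Proof.
move=> [mf [M fM]] [mg [N gN]]; split; first exact: measurable_funM.
by exists (M * N) => x; rewrite normrM ler_pM.
Qed.

Lemma bddZ c f : bdd_measurable f -> bdd_measurable (fun x => c * f x).
Proof. by apply: bddM; exact: bdd_cst. Qed.

Lemma bdd_sum (I : Type) (s : seq I) (F : I -> R -> R) :
  (forall i, bdd_measurable (F i)) -> bdd_measurable (fun x => \sum_(i <- s) F i x).
Proof.
move=> bF; elim: s => [|i s IH].
  by under eq_fun do rewrite big_nil; exact: bdd_cst.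
by under eq_fun do rewrite big_cons; exact: bddD.
Qed.

Lemma bdd_cos u v : bdd_measurable (fun x => cos (u * x + v)).
Proof.
split; last by exists 1 => x; exact: cos_max.
apply: continuous_measurable_fun => x.
apply: (@continuous_comp _ _ _ (fun x => u * x + v) cos); last exact: continuous_cos.
by apply: cvgD; [apply: cvgZr; exact: cvg_id|exact: cvg_cst].
Qed.

Lemma bdd_sin u v : bdd_measurable (fun x => sin (u * x + v)).
Proof.
split; last by exists 1 => x; exact: sin_max.
apply: continuous_measurable_fun => x.
apply: (@continuous_comp _ _ _ (fun x => u * x + v) sin); last exact: continuous_sin.
by apply: cvgD; [apply: cvgZr; exact: cvg_id|exact: cvg_cst].
Qed.

Lemma bdd_indic (B : set (measurableTypeR R)) : measurable B ->
  bdd_measurable (\1_B : R -> R).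
Proof.
move=> mB; split; first exact: measurable_indic.
by exists 1 => x; rewrite indicE; case: (_ \in _); rewrite ?normr0 ?normr1.
Qed.

Lemma Rintegral_full f (D : set (measurableTypeR R)) : measurable D ->
  mu D = 1%E -> bdd_measurable f ->
  \int[mu]_(x in D) f x = \int[mu]_x f x.
Proof.
move=> mD D1 bf; rewrite /Rintegral; congr fine.
have DC : mu (~` D) = 0%E by rewrite probability_setC // D1 subee.
rewrite [RHS](@negligible_integral _ _ _ _ setT (~` D)) //.
- by rewrite setTD setCK.
- exact: measurableC.
- exact: bdd_integrable.
Qed.

Lemma Rintegral_lin c f g : bdd_measurable f -> bdd_measurable g ->
  \int[mu]_x (c * f x + g x) = c * \int[mu]_x f x + \int[mu]_x g x.
Proof.
move=> bf bg; rewrite RintegralD //; [|exact/bdd_integrable/bddZ|exact/bdd_integrable].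
by rewrite RintegralZl //; exact/bdd_integrable.
Qed.

Lemma Rintegral_sum (I : Type) (s : seq I) (F : I -> R -> R) :
  (forall i, bdd_measurable (F i)) ->
  \int[mu]_x (\sum_(i <- s) F i x) = \sum_(i <- s) \int[mu]_x F i x.
Proof.
move=> bF; elim: s => [|i s IH].
  rewrite big_nil; under eq_Rintegral do rewrite big_nil.
  by rewrite Rintegral_cst // mul0r.
rewrite big_cons -IH -[X in X + _]mul1r -Rintegral_lin //; last exact: bdd_sum.
by apply: eq_Rintegral => x _; rewrite big_cons mul1r.
Qed.

Lemma Rintegral_prob_cst c : \int[mu]_x c = c.
Proof.
rewrite Rintegral_cst // [X in fine X](_ : _ = 1%E) ?mulr1 //.
exact: probability_setT.
Qed.

Lemma le_Rintegral_full f g (D : set (measurableTypeR R)) : measurable D ->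
  mu D = 1%E -> bdd_measurable f -> bdd_measurable g ->
  (forall x, D x -> f x <= g x) -> \int[mu]_x f x <= \int[mu]_x g x.
Proof.
move=> mD D1 bf bg fg.
rewrite -(Rintegral_full mD D1 bf) -(Rintegral_full mD D1 bg).
by apply: le_Rintegral => //; exact: bdd_integrable.
Qed.

Lemma Rintegral_indic (B : set (measurableTypeR R)) : measurable B ->
  \int[mu]_x (\1_B x : R) = fine (mu B).
Proof. by move=> mB; rewrite /Rintegral integral_indic // setIT. Qed.

End BoundedIntegrals.

(** The formula holds first for nonnegative functions, by the mixture measure. A bounded g is
    shifted by its bound M, which cancels because the weights sum to 1. *)
Lemma self_similar_Rintegral (R : realType) (A : finType) (r b p : A -> R)
    (mu : probability (measurableTypeR R) R) (g : R -> R) :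
  (forall w, 0 <= p w) -> \sum_w p w = 1 ->
  (forall B : set (measurableTypeR R), measurable B ->
     mu B = (\sum_w (p w)%:E *
       pushforward mu (similitude (r w) (b w) :
         measurableTypeR R -> measurableTypeR R) B)%E) ->
  bdd_measurable g ->
  \int[mu]_x g x = \sum_w p w * \int[mu]_x g (similitude (r w) (b w) x).
Proof.
move=> p0 p1 mu_ss bg.
have bgc w : bdd_measurable (fun x => g (similitude (r w) (b w) x)).
  case: bg => mg [M gM]; split; last by exists M.
  exact: (@measurableT_comp _ _ _ _ _ _ _ _ _ mg (@measurable_similitude R (r w) (b w))).
have ge0_case (h : R -> R) : bdd_measurable h -> (forall x, 0 <= h x) ->
    \int[mu]_x h x = \sum_w p w * \int[mu]_x h (similitude (r w) (b w) x).
  move=> bh h0.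
  have [nu [nuE nuI]] := sum_pushforward_measure (index_enum A) mu p0
    (fun w => @measurable_similitude R (r w) (b w)).
  rewrite /Rintegral (@eq_measure_integral _ _ _ _ nu); last first.
    by move=> B mB _; rewrite nuE; exact: mu_ss.
  have mh : measurable_fun (setT : set (measurableTypeR R)) (fun x => (h x)%:E).
    by apply/measurable_EFinP; case: bh.
  rewrite nuI //.
  have bhc w : bdd_measurable (fun x => h (similitude (r w) (b w) x)).
    case: bh => mh' [N hN]; split; last by exists N.
    exact: (@measurableT_comp _ _ _ _ _ _ _ _ _ mh' (@measurable_similitude R (r w) (b w))).
  have fin w : (\int[mu]_x (h (similitude (r w) (b w) x))%:E)%E \is a fin_num.
    by apply: integrable_fin_num => //; exact: bdd_integrable (bhc w).
  rewrite -sum_fine; last by move=> w _; rewrite fin_numM.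
  by apply: eq_bigr => w _; rewrite fineM.
have [mg [M gM]] := bg.
have bgM : bdd_measurable (fun x => g x + M) by apply: bddD => //; exact: bdd_cst.
have bM := bdd_cst (M : R).
have gM0 x : 0 <= g x + M by have := gM x; rewrite ler_norml; lra.
have := ge0_case _ bgM gM0.
rewrite RintegralD //; [|exact: bdd_integrable|exact: bdd_integrable].
rewrite Rintegral_prob_cst.
under eq_bigr => w _.
  rewrite RintegralD //; [|exact: bdd_integrable|exact: bdd_integrable].
  rewrite Rintegral_prob_cst mulrDr.
  over.
by rewrite big_split /= -mulr_suml p1 mul1r => /addIr.
Qed.

(** The variance of a under the weights p is nonnegative. *)
Lemma sum_sqr_le (R : realType) (A : finType) (p a : A -> R) :
  (forall w, 0 <= p w) -> \sum_w p w = 1 ->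
  (\sum_w p w * a w) ^+ 2 <= \sum_w p w * a w ^+ 2.
Proof.
move=> p0 p1.
have key m : \sum_w p w * (a w - m) ^+ 2 =
   \sum_w p w * a w ^+ 2 - 2 * m * (\sum_w p w * a w) + m ^+ 2 * \sum_w p w.
  rewrite !mulr_sumr -sumrB -big_split /=.
  by apply: eq_bigr => w _; ring.
have : 0 <= \sum_w p w * (a w - \sum_w p w * a w) ^+ 2.
  by apply: sumr_ge0 => w _; rewrite mulr_ge0 // sqr_ge0.
by rewrite key p1; nra.
Qed.

Section FourierEnergy.
Context (R : realType) (mu : probability (measurableTypeR R) R).

Definition ft_cos (u : R) : R := \int[mu]_x cos (u * x).
Definition ft_sin (u : R) : R := \int[mu]_x sin (u * x).
(* The squared modulus of the Fourier transform at frequency u / (2 pi). *)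
Definition energy (u : R) : R := ft_cos u ^+ 2 + ft_sin u ^+ 2.

Lemma energy_ge0 u : 0 <= energy u.
Proof. by rewrite /energy addr_ge0 // sqr_ge0. Qed.

Lemma bdd_cos0 (u : R) : bdd_measurable (fun x => cos (u * x)).
Proof. by under eq_fun do rewrite -[u * _]addr0; exact: bdd_cos. Qed.

Lemma bdd_sin0 (u : R) : bdd_measurable (fun x => sin (u * x)).
Proof. by under eq_fun do rewrite -[u * _]addr0; exact: bdd_sin. Qed.

Hypothesis mu01 : mu (`[0, 1]%classic : set R) = 1%E.
Let mI : measurable (`[0, 1]%classic : set (measurableTypeR R)) := @measurable_itv R _.

Lemma ft_lip (t : R -> R) (u v : R) :
  (forall x y, `|t x - t y| <= `|x - y|) -> (forall u, bdd_measurable (fun x => t (u * x))) ->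
  \int[mu]_x t (u * x) <= \int[mu]_x t (v * x) + `|u - v|.
Proof.
move=> tlip bt.
rewrite -(Rintegral_prob_cst mu `|u - v|) -RintegralD //;
  [|exact: bdd_integrable|exact/bdd_integrable/bdd_cst].
apply: (le_Rintegral_full mI mu01) => //; first by apply: bddD => //; exact: bdd_cst.
move=> x; rewrite /= in_itv /= => /andP[x0 x1].
have := tlip (u * x) (v * x); rewrite -mulrBl normrM (ger0_norm x0) => h.
have := ler_norm (t (u * x) - t (v * x)); have := normr_ge0 (u - v).
nra.
Qed.

Lemma ft_cos_lip u v : `|ft_cos u - ft_cos v| <= `|u - v|.
Proof.
have h1 := ft_lip u v (@cos_lip R) bdd_cos0.
have h2 := ft_lip v u (@cos_lip R) bdd_cos0.
by rewrite ler_norml; rewrite (distrC v) in h2; rewrite /ft_cos; lra.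
Qed.

Lemma ft_sin_lip u v : `|ft_sin u - ft_sin v| <= `|u - v|.
Proof.
have h1 := ft_lip u v (@sin_lip R) bdd_sin0.
have h2 := ft_lip v u (@sin_lip R) bdd_sin0.
by rewrite ler_norml; rewrite (distrC v) in h2; rewrite /ft_sin; lra.
Qed.

Lemma Rintegral_le1 (f : R -> R) : bdd_measurable f -> (forall x, `|f x| <= 1) ->
  `|\int[mu]_x f x| <= 1.
Proof.
move=> bf f1; rewrite ler_norml; apply/andP; split.
  rewrite -(Rintegral_prob_cst mu (-1)).
  apply: (le_Rintegral_full mI mu01) => //; first exact: bdd_cst.
  by move=> x _; have := f1 x; rewrite ler_norml => /andP[].
rewrite -[leRHS](Rintegral_prob_cst mu 1).
apply: (le_Rintegral_full mI mu01) => //; first exact: bdd_cst.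
by move=> x _; have := f1 x; rewrite ler_norml => /andP[].
Qed.

(** Both coordinates are bounded by 1 and 1-Lipschitz, as mu lives on [[0, 1]]; so each square
    contributes 2 |u - v|. *)
Lemma energy_lip u v : energy u <= energy v + 4 * `|u - v|.
Proof.
have c1 := ft_cos_lip u v; have s1 := ft_sin_lip u v.
have cu : `|ft_cos u| <= 1 by apply: Rintegral_le1; [exact: bdd_cos0|move=> x; exact: cos_max].
have cv : `|ft_cos v| <= 1 by apply: Rintegral_le1; [exact: bdd_cos0|move=> x; exact: cos_max].
have su : `|ft_sin u| <= 1 by apply: Rintegral_le1; [exact: bdd_sin0|move=> x; exact: sin_max].
have sv : `|ft_sin v| <= 1 by apply: Rintegral_le1; [exact: bdd_sin0|move=> x; exact: sin_max].
have sq (a a' d : R) : `|a - a'| <= d -> `|a| <= 1 -> `|a'| <= 1 -> a ^+ 2 <= a' ^+ 2 + 2 * d.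
  move=> h1 h2 h3.
  have -> : a ^+ 2 = a' ^+ 2 + (a - a') * (a + a') by ring.
  rewrite lerD2l; apply: le_trans (ler_norm _) _; rewrite normrM mulrC.
  by apply: ler_pM => //; apply: le_trans (ler_normD _ _) _; lra.
have := sq _ _ _ c1 cu cv; have := sq _ _ _ s1 su sv.
by rewrite /energy; lra.
Qed.

Lemma energy_even u : energy (- u) = energy u.
Proof.
rewrite /energy /ft_cos /ft_sin; congr (_ ^+ 2 + _).
  by apply: eq_Rintegral => x _; rewrite mulNr cosN.
rewrite (_ : \int[mu]_x sin (- u * x) = - \int[mu]_x sin (u * x)) ?sqrrN //.
rewrite -[RHS]mulN1r -RintegralZl //; last exact/bdd_integrable/bdd_sin0.
by apply: eq_Rintegral => x _; rewrite mulNr sinN mulN1r.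
Qed.

(** The transform at u is the average of the transforms at r_w u, each rotated by the angle u b_w.
    Convexity of the square applies to both coordinates, and rotations preserve the modulus. *)
Lemma energy_self_similar (A : finType) (r b p : A -> R) u :
  (forall w, 0 <= p w) -> \sum_w p w = 1 ->
  (forall B : set (measurableTypeR R), measurable B ->
     mu B = (\sum_w (p w)%:E *
       pushforward mu (similitude (r w) (b w) :
         measurableTypeR R -> measurableTypeR R) B)%E) ->
  energy u <= \sum_w p w * energy (r w * u).
Proof.
move=> p0 p1 mu_ss.
have cE : ft_cos u = \sum_w p w *
    (cos (u * b w) * ft_cos (r w * u) - sin (u * b w) * ft_sin (r w * u)).
  rewrite /ft_cos (self_similar_Rintegral p0 p1 mu_ss (bdd_cos0 u)).
  apply: eq_bigr => w _; congr (_ * _).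
  (* An integral of 0 is appended so that both terms fit the shape c * f + g of [Rintegral_lin]. *)
  rewrite -mulNr -[X in _ + X]addr0 -(Rintegral_prob_cst mu 0).
  rewrite -Rintegral_lin; [|exact: bdd_sin0|exact: bdd_cst].
  rewrite -Rintegral_lin; [|exact: bdd_cos0|]; last first.
    by apply: bddD; [exact/bddZ/bdd_sin0|exact: bdd_cst].
  apply: eq_Rintegral => x _; rewrite /similitude.
  have -> : u * (r w * x + b w) = u * b w + r w * u * x by ring.
  by rewrite cosD; ring.
have sE : ft_sin u = \sum_w p w *
    (sin (u * b w) * ft_cos (r w * u) + cos (u * b w) * ft_sin (r w * u)).
  rewrite /ft_sin (self_similar_Rintegral p0 p1 mu_ss (bdd_sin0 u)).
  apply: eq_bigr => w _; congr (_ * _).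
  rewrite -[X in _ + X]addr0 -(Rintegral_prob_cst mu 0).
  rewrite -Rintegral_lin; [|exact: bdd_sin0|exact: bdd_cst].
  rewrite -Rintegral_lin; [|exact: bdd_cos0|]; last first.
    by apply: bddD; [exact/bddZ/bdd_sin0|exact: bdd_cst].
  apply: eq_Rintegral => x _; rewrite /similitude.
  have -> : u * (r w * x + b w) = u * b w + r w * u * x by ring.
  by rewrite sinD; ring.
rewrite /energy {1}cE {1}sE.
apply: le_trans (lerD (sum_sqr_le _ p0 p1) (sum_sqr_le _ p0 p1)) _.
rewrite -big_split /=; apply: ler_sum => w _; rewrite -mulrDr ler_wpM2l //.
set c := cos _; set s := sin _; set C := ft_cos _; set S := ft_sin _.
have cs : c ^+ 2 + s ^+ 2 = 1 by rewrite cos2Dsin2.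
have -> : (c * C - s * S) ^+ 2 + (s * C + c * S) ^+ 2 =
   (c ^+ 2 + s ^+ 2) * (C ^+ 2 + S ^+ 2) by ring.
by rewrite cs mul1r.
Qed.

(** The energy at u is the double integral of cos (u (x - y)). Pairs closer than rho have small mass
    by the ball condition; for the others the sum over j oscillates. [K x] is the inner integral,
    expanded by the addition formula. *)
Lemma energy_average (c s h rho : R) (N : nat) :
  (forall x : R, (mu `[(x - rho)%R, (x + rho)%R]%classic <= (c * rho `^ s)%:E)%E) ->
  0 < h <= 1 -> 0 < rho ->
  \sum_(j < N) energy (j%:R * h) <= N%:R * (c * rho `^ s) + 4 / (h * rho).
Proof.
move=> ball /andP[h0 h1] rho0.
pose K x := \sum_(j < N) (cos (j%:R * h * x) * ft_cos (j%:R * h) +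
                          sin (j%:R * h * x) * ft_sin (j%:R * h)).
have bK : bdd_measurable K.
  apply: bdd_sum => j; apply: bddD; apply: bddM; solve
    [exact: bdd_cos0|exact: bdd_sin0|exact: bdd_cst].
have -> : \sum_(j < N) energy (j%:R * h) = \int[mu]_x K x.
  rewrite Rintegral_sum => [|j].
    apply: eq_bigr => j _; rewrite /energy !expr2.
    rewrite {1}/ft_cos {2}/ft_sin -!RintegralZr //;
      [|exact/bdd_integrable/bdd_sin0|exact/bdd_integrable/bdd_cos0].
    by rewrite RintegralD //; apply: bdd_integrable => //; apply: bddM;
      solve [exact: bdd_cos0|exact: bdd_sin0|exact: bdd_cst].
  by apply: bddD; apply: bddM; solve
    [exact: bdd_cos0|exact: bdd_sin0|exact: bdd_cst].
rewrite -[leRHS](Rintegral_prob_cst mu).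
apply: (le_Rintegral_full mI mu01) => //; first exact: bdd_cst.
move=> x; rewrite /= in_itv /= => /andP[x0 x1].
(* The kernel is the Dirichlet kernel of h (x - y): at most N if |x - y| <= rho,
   and O(1 / (h rho)) otherwise. *)
have KE : K x = \int[mu]_y \sum_(j < N) cos (j%:R * (h * (x - y))).
  rewrite Rintegral_sum => [|j].
    apply: eq_bigr => j _; rewrite -RintegralZl //; last exact/bdd_integrable/bdd_cos0.
    rewrite -RintegralZl //; last exact/bdd_integrable/bdd_sin0.
    rewrite -RintegralD //; [|exact/bdd_integrable/bddZ/bdd_cos0|exact/bdd_integrable/bddZ/bdd_sin0].
    apply: eq_Rintegral => y _; rewrite -cosB; congr cos; ring.
  rewrite (_ : (fun y => _) = fun y => cos (- (j%:R * h) * y + j%:R * h * x)); first exact: bdd_cos.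
  by apply/funext => y; congr cos; ring.
pose B : set (measurableTypeR R) := (`[x - rho, x + rho]%classic : set R).
have mB : measurable B by exact: measurable_itv.
rewrite KE; apply: (@le_trans _ _ (\int[mu]_y (N%:R * \1_B y + 4 / (h * rho)))).
  apply: (le_Rintegral_full mI mu01).
  - apply: bdd_sum => j.
    rewrite (_ : (fun y => _) = fun y => cos (- (j%:R * h) * y + j%:R * h * x)); first exact: bdd_cos.
    by apply/funext => y; congr cos; ring.
  - by apply: bddD; [exact/bddZ/bdd_indic|exact: bdd_cst].
  move=> y; rewrite /= in_itv /= => /andP[y0 y1].
  have sumN : \sum_(j < N) cos (j%:R * (h * (x - y))) <= N%:R.
    rewrite -[leRHS]mulr1 -mulr_natr.
    apply: le_trans (ler_sum _ (fun j _ => cos_le1 _)) _.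
    by rewrite sumr_const card_ord mulr1 mul1r.
  have c0 : 0 < 4 / (h * rho) by rewrite divr_gt0 // mulr_gt0.
  rewrite indicE; have [yB|yB] := boolP (y \in B); first by rewrite mulr1; lra.
  have rxy : rho < `|x - y|.
    rewrite ltNge; apply/negP; rewrite ler_norml => hxy.
    move/negP: yB; apply; rewrite inE /B /= in_itv /=.
    by apply/andP; split; lra.
  rewrite mulr0 add0r.
  under eq_bigr => j _.
    rewrite -cos_norm normrM (ger0_norm (ler0n _ _)) normrM (gtr0_norm h0).
    over.
  apply: le_trans (ler_norm _) _.
  apply: le_trans (dirichlet_bound _ _) _.
    apply/andP; split; first by rewrite mulr_gt0 // (lt_trans rho0).
    have xy1 : `|x - y| <= 1 by rewrite ler_norml; lra.
    by rewrite -[leRHS]mulr1 ler_pM // ltW.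
  have xy0 := lt_trans rho0 rxy.
  rewrite ler_wpM2l // lef_pV2 ?posrE ?mulr_gt0 //.
  by rewrite ler_wpM2l // ltW.
have -> : \int[mu]_y (N%:R * \1_B y + 4 / (h * rho)) =
    N%:R * \int[mu]_y (\1_B y : R) + \int[mu]_y (4 / (h * rho)).
  by apply: Rintegral_lin; [exact: bdd_indic|exact: bdd_cst].
rewrite Rintegral_prob_cst Rintegral_indic // lerD2r ler_wpM2l //.
have := ball x; rewrite -lee_fin; apply: le_trans.
by rewrite fineK // fin_num_measure.
Qed.

End FourierEnergy.

(** * Occupation measure of a random walk *)

Section ComplexNorm.
Context (R : realType).
Implicit Types x y : R[i].
Local Notation nc := (@Normc.normc R).

Definition cis (t : R) : R[i] := (cos t +i* sin t)%C.

Lemma cisD s t : cis (s + t) = cis s * cis t.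
Proof.
by rewrite /cis cosD sinD; apply/eqP; rewrite eq_complex /= eqxx /= addrC eqxx.
Qed.

Lemma cis0 : cis 0 = 1.
Proof. by rewrite /cis cos0 sin0. Qed.

Lemma nc_cis t : nc (cis t) = 1.
Proof. by rewrite /= cos2Dsin2 sqrtr1. Qed.

Lemma nc_ge0 x : 0 <= nc x.
Proof. by case: x => a b /=; exact: sqrtr_ge0. Qed.

Lemma ncD x y : nc (x + y) <= nc x + nc y.
Proof. exact: le_normcD. Qed.

Lemma nc_sum (I : Type) (s : seq I) (P : pred I) (F : I -> R[i]) :
  nc (\sum_(i <- s | P i) F i) <= \sum_(i <- s | P i) nc (F i).
Proof.
elim/big_rec2: _ => [|i y x _ h]; first by rewrite Normc.normc0.
by apply: le_trans (ncD _ _) _; rewrite lerD2l.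
Qed.

Lemma ncX x n : nc (x ^+ n) = nc x ^+ n.
Proof.
elim: n => [|n IH]; first by rewrite !expr0 Normc.normc1.
by rewrite !exprS Normc.normcM IH.
Qed.

Lemma nc_real (a : R) : nc a%:C%C = `|a|.
Proof. by rewrite /= expr0n addr0 sqrtr_sqr. Qed.

Lemma normRe_le x : `|complex.Re x| <= nc x.
Proof. by case: x => a b /=; rewrite -sqrtr_sqr ler_wsqrtr // lerDl sqr_ge0. Qed.

Lemma normIm_le x : `|complex.Im x| <= nc x.
Proof. by case: x => a b /=; rewrite -sqrtr_sqr ler_wsqrtr // lerDr sqr_ge0. Qed.

Lemma Re_sum (I : Type) (s : seq I) (P : pred I) (F : I -> R[i]) :
  complex.Re (\sum_(i <- s | P i) F i) = \sum_(i <- s | P i) complex.Re (F i).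
Proof. by elim/big_rec2: _ => [//|i y x _ <-]; case: (F i) x => [a b] [c d]. Qed.

Lemma Im_sum (I : Type) (s : seq I) (P : pred I) (F : I -> R[i]) :
  complex.Im (\sum_(i <- s | P i) F i) = \sum_(i <- s | P i) complex.Im (F i).
Proof. by elim/big_rec2: _ => [//|i y x _ <-]; case: (F i) x => [a b] [c d]. Qed.

Lemma Re_realM (a : R) x : complex.Re (a%:C%C * x) = a * complex.Re x.
Proof. by case: x => b c /=; rewrite mul0r subr0. Qed.

Lemma Im_realM (a : R) x : complex.Im (a%:C%C * x) = a * complex.Im x.
Proof. by case: x => b c /=; rewrite mul0r addr0. Qed.

End ComplexNorm.

Section Walk.
Context (R : realType) (I : finType) (q z : I -> R).
Local Notation nc := (@Normc.normc R).
Hypothesis q_ge0 : forall i, 0 <= q i.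
Hypothesis q_sum1 : \sum_i q i = 1.
Implicit Types f g : R -> R.

(** The random walk is represented by its transition operator: [walk n f s] is the expectation of f
    after n steps from s, and [occupation] sums expectations over a range of times, starting at
    0. *)
Definition walk_step f (s : R) : R := \sum_i q i * f (s + z i).

Definition walk n f : R -> R := iter n walk_step f.

Definition occupation (n0 n1 : nat) f : R := \sum_(n0 <= n < n1) walk n f 0.

Lemma walk_step_le f g s : (forall i, f (s + z i) <= g (s + z i)) ->
  walk_step f s <= walk_step g s.
Proof. by move=> fg; apply: ler_sum => i _; rewrite ler_wpM2l. Qed.

Lemma walk_le n f g : (forall s, f s <= g s) -> forall s, walk n f s <= walk n g s.
Proof. by move=> fg; elim: n => [//|n IH] s; apply: walk_step_le => i; exact: IH. Qed.

Lemma walk_cst n c s : walk n (fun=> c) s = c.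
Proof.
elim: n s => [//|n IH] s; rewrite /walk iterS -/(walk n _) /walk_step.
by under eq_bigr do rewrite IH; rewrite -mulr_suml q_sum1 mul1r.
Qed.

Lemma walk_ge0 n f s : (forall s, 0 <= f s) -> 0 <= walk n f s.
Proof. by move=> f0; have := @walk_le n (fun=> 0) f f0 s; rewrite walk_cst. Qed.

Lemma walk_sum n (J : Type) (r : seq J) (c : J -> R) (F : J -> R -> R) s :
  walk n (fun s => \sum_(j <- r) c j * F j s) s =
  \sum_(j <- r) c j * walk n (F j) s.
Proof.
elim: n s => [//|n IH] s; rewrite /walk iterS -/(walk n _) /walk_step.
under eq_bigr do rewrite IH mulr_sumr.
rewrite exchange_big /=; apply: eq_bigr => j _.
by rewrite mulr_sumr; apply: eq_bigr => i _; rewrite mulrCA.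
Qed.

Lemma occupation_le n0 n1 f g : (forall s, f s <= g s) ->
  occupation n0 n1 f <= occupation n0 n1 g.
Proof. by move=> fg; apply: ler_sum => n _; exact: walk_le. Qed.

Lemma occupation_sum n0 n1 (J : Type) (r : seq J) (c : J -> R) (F : J -> R -> R) :
  occupation n0 n1 (fun s => \sum_(j <- r) c j * F j s) =
  \sum_(j <- r) c j * occupation n0 n1 (F j).
Proof.
rewrite /occupation; under eq_bigr do rewrite walk_sum.
by rewrite exchange_big /=; apply: eq_bigr => j _; rewrite mulr_sumr.
Qed.

Section Hitting.
Variables (m M t : R) (g : R -> R).
Hypothesis zm : forall i, m <= z i.
Hypothesis zM : forall i, z i <= M.
Hypothesis g_ge0 : forall s, 0 <= g s.
Hypothesis g_sub : forall s, g s <= walk_step g s.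

Let h (s : R) : R := g s * (t <= s <= t + M)%R%:R.

Let h_ge0 s : 0 <= h s.
Proof. by rewrite /h mulr_ge0. Qed.

(* As no step exceeds M, the walk visits the window [t, t + M]; summing over all
   visits instead of stopping at the first one only increases the bound. *)
Lemma hitting_le k s : s <= t + M -> t <= s + k%:R * m ->
  g s <= \sum_(n < k.+1) walk n h s.
Proof.
elim: k s => [|k IH] s sM.
  rewrite mul0r addr0 => ts; rewrite big_ord_recl big_ord0 addr0 /=.
  by rewrite /h ts sM mulr1.
move=> ts.
have -> : \sum_(n < k.+2) walk n h s = h s + \sum_(i < k.+1) walk i.+1 h s.
  by rewrite big_ord_recl.
have [ts'|st] := leP t s.
  rewrite {1}/h ts' sM mulr1 lerDl.
  by apply: sumr_ge0 => i _; exact: walk_ge0.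
apply: (@le_trans _ _ (\sum_(i < k.+1) walk i.+1 h s)); last first.
  by rewrite lerDr; exact: h_ge0.
have -> : \sum_(i < k.+1) walk i.+1 h s =
    walk_step (fun s => \sum_(i < k.+1) walk i h s) s.
  rewrite /walk_step; under [RHS]eq_bigr do rewrite mulr_sumr.
  by rewrite exchange_big.
apply: le_trans (g_sub s) _; apply: walk_step_le => i; apply: IH.
  by have := zM i; lra.
by have := zm i; move: ts; rewrite -natr1; lra.
Qed.

Lemma walk_before n s : s + n%:R * M < t -> walk n h s = 0.
Proof.
elim: n s => [|n IH] s sn.
  by rewrite /= /h leNgt; move: sn; rewrite mul0r addr0 => ->; rewrite mulr0.
rewrite /walk iterS -/(walk n _) /walk_step big1 // => i _.
rewrite IH ?mulr0 //; have := zM i; move: sn; rewrite -natr1; lra.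
Qed.

(** Steps of at most M cannot bring the walk to t before time t / M, and steps of at least m do so
    by time t / m. Discarding the early times is what later makes powers of the characteristic
    function small. *)
Lemma hitting n0 n1 : 0 < M -> 0 < t -> n0%:R * M <= t -> t <= n1%:R * m ->
  g 0 <= occupation n0 n1.+1 h.
Proof.
move=> M0 t0 n0t n1t.
apply: (le_trans (hitting_le (k := n1) _ _)); rewrite ?add0r ?addr_ge0 ?(ltW t0) ?(ltW M0) //.
have [n01|n10] := leqP n0 n1.+1; last first.
  rewrite big1; first by apply: sumr_ge0 => i _; exact: walk_ge0.
  move=> i _.
  apply: walk_before; rewrite add0r; apply: lt_le_trans n0t.
  by rewrite ltr_pM2r // ltr_nat (ltn_trans (ltn_ord i) n10).
rewrite -(big_mkord xpredT (fun n => walk n h 0)) (big_cat_nat (leq0n n0) n01) //=.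
rewrite [X in X + _]big1_seq ?add0r //= => n; rewrite mem_index_iota /= => nn0.
apply: walk_before; rewrite add0r; apply: lt_le_trans n0t.
by rewrite ltr_pM2r // ltr_nat.
Qed.

End Hitting.
End Walk.

(** * Mass of a short cell, from the characteristic function of a step *)

Section CharacteristicFunction.
Context (R : realType) (I : finType) (q z : I -> R).
Local Notation nc := (@Normc.normc R).
Hypothesis q_ge0 : forall i, 0 <= q i.
Hypothesis q_sum1 : \sum_i q i = 1.

Definition char_fun (theta : R) : R[i] := \sum_i (q i)%:C%C * cis (theta * z i).

Definition char_geom n0 n1 (theta : R) : R[i] :=
  \sum_(n0 <= n < n1) char_fun theta ^+ n.

Lemma walk_cis n c theta s :
  walk q z n (fun s => complex.Re (c * cis (theta * s))) s =
  complex.Re (c * char_fun theta ^+ n * cis (theta * s)).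
Proof.
elim: n s => [|n IH] s; first by rewrite expr0 mulr1.
rewrite /walk iterS -/(walk q z n _) /walk_step.
under eq_bigr do rewrite IH -Re_realM.
rewrite -Re_sum; congr complex.Re.
rewrite exprS [char_fun theta * _]mulrC /char_fun.
rewrite mulrA mulr_sumr mulr_suml; apply: eq_bigr => i _.
by rewrite mulrDr cisD; ring.
Qed.

Lemma occupation_cis_le n0 n1 theta y :
  occupation q z n0 n1 (fun s => cos (theta * (s - y))) <=
  nc (char_geom n0 n1 theta).
Proof.
have cE s : cos (theta * (s - y)) = complex.Re (cis (- (theta * y)) * cis (theta * s)).
  by rewrite -cisD /=; congr cos; ring.
rewrite (_ : (fun s => _) = fun s => complex.Re (cis (- (theta * y)) * cis (theta * s))).
  2: exact/funext.
rewrite /occupation.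
under eq_bigr do rewrite walk_cis mulr0 cis0 mulr1.
rewrite -Re_sum -mulr_sumr; apply: le_trans (ler_norm _) _.
by apply: le_trans (normRe_le _) _; rewrite Normc.normcM nc_cis mul1r.
Qed.

Lemma char_funN theta : char_fun (- theta) = conjc (char_fun theta).
Proof.
rewrite /char_fun rmorph_sum; apply: eq_bigr => i _; rewrite rmorphM /=.
rewrite mulNr /cis cosN sinN; congr (_ * _).
by apply/eqP; rewrite eq_complex /= oppr0 !eqxx.
Qed.

Lemma char_geomN n0 n1 theta : nc (char_geom n0 n1 (- theta)) = nc (char_geom n0 n1 theta).
Proof.
have -> : char_geom n0 n1 (- theta) = conjc (char_geom n0 n1 theta).
  rewrite /char_geom rmorph_sum; apply: eq_bigr => n _.
  by rewrite char_funN rmorphXn.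
by case: (char_geom _ _ _) => a b /=; rewrite sqrrN.
Qed.

(** With truncated subtraction [k - j + (j - k)] is |k - j|, and each distance is taken by at most
    two values of j. *)
Lemma sum_dist_le (a : nat -> R) (K k : nat) : (k < K)%N -> (forall d, 0 <= a d) ->
  \sum_(j < K) a (k - j + (j - k))%N <= 2 * \sum_(d < K) a d.
Proof.
move=> kK a0; rewrite -(big_mkord xpredT a) -(big_mkord xpredT (fun j => a (k - j + (j - k))%N)).
rewrite (big_cat_nat (leq0n k.+1) kK) /=.
have -> : 2 * \sum_(0 <= d < K) a d = \sum_(0 <= d < K) a d + \sum_(0 <= d < K) a d by ring.
apply: lerD.
  rewrite big_nat_rev /= (eq_big_nat _ _ (F2 := a)) => [|i /andP[_ ik]]; last first.
    by congr a; rewrite add0n; lia.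
  by rewrite (big_cat_nat (leq0n k.+1) kK) /= lerDl sumr_ge0.
rewrite -{1}[k.+1]add0n big_addn.
rewrite (eq_bigr (fun i => a i.+1)) => [|i _]; last by congr a; lia.
have h : (0 <= 1)%N by [].
case: K kK => [//|K] kK.
rewrite [leRHS](big_ltn) //.
apply: (@le_trans _ _ (\sum_(1 <= i < K.+1) a i)); last by rewrite lerDr.
have hk : (K.+1 - k.+1 <= K)%N by lia.
rewrite big_add1 [leRHS]/= [leRHS](big_cat_nat (leq0n _) hk) /=.
by rewrite lerDl sumr_ge0.
Qed.

(* Up to the factor K, the double sum is the Fejer kernel at omega x. *)
Lemma fejer_sumE (K : nat) (omega x : R) :
  \sum_(k < K) \sum_(j < K) cos ((k%:R - j%:R) * omega * x) =
   (\sum_(k < K) cos (k%:R * omega * x)) ^+ 2 +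
   (\sum_(k < K) sin (k%:R * omega * x)) ^+ 2.
Proof.
rewrite !expr2 !mulr_suml -big_split /=; apply: eq_bigr => k _.
rewrite !mulr_sumr -big_split /=; apply: eq_bigr => j _.
by rewrite -cosB; congr cos; ring.
Qed.

(** On the cell every phase k omega (s - y) is between 0 and 1, so each cosine is at least 1/2 and
    the cosine sum alone gives (K / 2) ^ 2. *)
Lemma fejer_majorant (K : nat) (omega delta s y : R) :
  0 <= omega -> K%:R * omega * delta <= 1 -> y <= s <= y + delta ->
  K%:R ^+ 2 / 4 <= \sum_(k < K) \sum_(j < K) cos ((k%:R - j%:R) * omega * (s - y)).
Proof.
move=> w0 Kd /andP[ys sy].
rewrite fejer_sumE.
set C := \sum_(k < K) cos _; set S := \sum_(k < K) sin _.
have CK : K%:R / 2 <= C.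
  have -> : K%:R / 2 = \sum_(k < K) (1 / 2 : R).
    by rewrite sumr_const card_ord -[RHS]mulr_natl div1r.
  apply: ler_sum => k _; apply: cos_ge_half.
  have d0 : 0 <= s - y by rewrite subr_ge0.
  rewrite ger0_norm ?mulr_ge0 //; apply: le_trans Kd.
  apply: ler_pM; rewrite ?mulr_ge0 //; last by lra.
  by rewrite ler_wpM2r // ler_nat ltnW.
have K0 : 0 <= K%:R :> R by [].
have S0 := sqr_ge0 S.
nra.
Qed.

(** 4 / K ^ 2 times the double cosine sum is nonnegative everywhere and at least 1 on the cell. Each
    of its K rows costs at most twice the sum over distances, whence 8 / K. *)
Lemma occupation_cell (K n0 n1 : nat) (omega delta y : R) :
  (0 < K)%N -> 0 <= omega -> K%:R * omega * delta <= 1 ->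
  occupation q z n0 n1 (fun s => (y <= s <= y + delta)%R%:R) <=
  8 / K%:R * \sum_(d < K) nc (char_geom n0 n1 (d%:R * omega)).
Proof.
move=> K0 w0 Kd; have K0' : 0 < K%:R :> R by rewrite ltr0n.
pose T s := \sum_(k < K) 4 / K%:R ^+ 2 *
  \sum_(j < K) 1 * cos ((k%:R - j%:R) * omega * (s - y)).
apply: (@le_trans _ _ (occupation q z n0 n1 T)).
  apply: occupation_le => // s; rewrite /T -mulr_sumr.
  under eq_bigr do under eq_bigr do rewrite mul1r.
  case: (boolP (y <= s <= y + delta)) => [h|_].
    have -> : true%:R = 4 / K%:R ^+ 2 * (K%:R ^+ 2 / 4) :> R.
      by rewrite mulr1n; field; rewrite lt0r_neq0.
    by rewrite ler_wpM2l ?divr_ge0 ?exprn_ge0 // (fejer_majorant w0 Kd h).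
  by rewrite mulr_ge0 ?divr_ge0 ?exprn_ge0 // fejer_sumE addr_ge0 ?sqr_ge0.
rewrite /T occupation_sum; under eq_bigr do rewrite occupation_sum.
have -> : 8 / K%:R * \sum_(d < K) nc (char_geom n0 n1 (d%:R * omega)) =
  \sum_(k < K) 4 / K%:R ^+ 2 * (2 * \sum_(d < K) nc (char_geom n0 n1 (d%:R * omega))).
  rewrite sumr_const card_ord -mulr_natr; field.
  by rewrite lt0r_neq0.
apply: ler_sum => k _; rewrite ler_wpM2l ?divr_ge0 ?exprn_ge0 //.
apply: le_trans (_ : _ <= \sum_(j < K) nc (char_geom n0 n1 ((k - j + (j - k))%N%:R * omega))) _; last first.
  apply: (@sum_dist_le (fun d => nc (char_geom n0 n1 (d%:R * omega)))) => [|d].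
    exact: ltn_ord.
  exact: nc_ge0.
apply: ler_sum => j _; rewrite mul1r.
apply: le_trans (occupation_cis_le _ _ _ _) _.
have [jk|kj] := leqP j k.
  have -> : (k - j + (j - k))%N%:R = k%:R - j%:R :> R.
    by rewrite -natrB //; congr (_%:R); lia.
  exact: lexx.
have -> : (k - j + (j - k))%N%:R = j%:R - k%:R :> R.
  by rewrite -natrB ?(ltnW kj) //; congr (_%:R); lia.
by rewrite -char_geomN -mulNr opprB.
Qed.

End CharacteristicFunction.

Section CharGeomBounds.
Context (R : realType) (I : finType) (q z : I -> R).
Local Notation nc := (@Normc.normc R).
Hypothesis q_ge0 : forall i, 0 <= q i.
Hypothesis q_sum1 : \sum_i q i = 1.
Local Notation psi := (char_fun q z).
Local Notation Psi := (char_geom q z).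

Lemma nc_char_fun_le1 theta : nc (psi theta) <= 1.
Proof.
apply: le_trans (nc_sum _ _ _) _; rewrite -q_sum1; apply: ler_sum => i _.
by rewrite Normc.normcM nc_cis mulr1 nc_real ger0_norm.
Qed.

Lemma nc_char_geom_le n0 n1 theta : nc (Psi n0 n1 theta) <= n1%:R.
Proof.
apply: le_trans (nc_sum _ _ _) _.
apply: (@le_trans _ _ (\sum_(n0 <= n < n1) 1)).
  by apply: ler_sum => n _; rewrite ncX exprn_ile1 ?nc_ge0 ?nc_char_fun_le1.
by rewrite sumr_const_nat ler_nat leq_subr.
Qed.

Lemma char_geomE n0 n1 theta : (n0 <= n1)%N ->
  (1 - psi theta) * Psi n0 n1 theta = psi theta ^+ n0 - psi theta ^+ n1.
Proof.
move=> n01; rewrite /char_geom mulr_sumr.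
under eq_bigr do rewrite mulrBl mul1r -exprS.
rewrite -opprB -(telescope_sumr (fun n => psi theta ^+ n) n01) -sumrN.
by apply: eq_bigr => n _; rewrite opprB.
Qed.

(** All steps are positive, so for theta z_i <= 1 the imaginary part of the characteristic function
    is at least m theta / 2. This bounds |1 - psi| below, and the geometric series is at most 2 / |1
    - psi|. *)
Lemma nc_char_geom_small m M n0 n1 theta :
  0 < m -> (forall i, m <= z i) -> (forall i, z i <= M) -> (n0 <= n1)%N ->
  0 < theta -> theta * M <= 1 -> nc (Psi n0 n1 theta) <= 4 / (m * theta).
Proof.
move=> m0 zm zM n01 t0 tM.
have low : m * theta / 2 <= nc (1 - psi theta).
  apply: le_trans (normIm_le _); rewrite raddfB /= sub0r normrN.
  apply: le_trans (ler_norm _); rewrite /char_fun Im_sum.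
  under eq_bigr do rewrite Im_realM.
  have -> : m * theta / 2 = \sum_i q i * (m * theta / 2).
    by rewrite -mulr_suml q_sum1 mul1r.
  apply: ler_sum => i _.
  rewrite ler_wpM2l //=.
  have zi : 0 <= theta * z i <= 1.
    rewrite mulr_ge0 ?(ltW t0) ?(le_trans (ltW m0)) //=.
    by apply: le_trans tM; rewrite ler_wpM2l // ltW.
  apply: le_trans (sin_ge_half zi).
  by rewrite ler_wpM2r // mulrC ler_wpM2l // ltW.
have := congr1 nc (char_geomE theta n01); rewrite Normc.normcM => e.
have up : nc (1 - psi theta) * nc (Psi n0 n1 theta) <= 2.
  rewrite e; apply: le_trans (ncD _ _) _.
  rewrite -mulN1r Normc.normcM !ncX.
  have -> : nc (-1) = 1 by rewrite normcN Normc.normc1.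
  have c1 := nc_char_fun_le1 theta; have c0 := nc_ge0 (psi theta).
  have := exprn_ile1 n0 c0 c1; have := exprn_ile1 n1 c0 c1; lra.
rewrite ler_pdivlMr ?mulr_gt0 //.
have := nc_ge0 (Psi n0 n1 theta).
nra.
Qed.

Lemma nc_char_geom_decay kappa n0 n1 theta : nc (psi theta) <= 1 - kappa ->
  nc (Psi n0 n1 theta) <= n1%:R * expR (- (kappa * n0%:R)).
Proof.
move=> psik; apply: le_trans (nc_sum _ _ _) _.
apply: (@le_trans _ _ (\sum_(n0 <= n < n1) expR (- (kappa * n0%:R)))).
  rewrite big_nat_cond [leRHS]big_nat_cond; apply: ler_sum => n /andP[/andP[n0n _] _].
  rewrite ncX; apply: (@le_trans _ _ (nc (psi theta) ^+ n0)).
    by rewrite ler_wiXn2l // ?nc_ge0 ?nc_char_fun_le1.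
  have -> : expR (- (kappa * n0%:R)) = expR (- kappa) ^+ n0.
    by rewrite -expRM_natl; congr expR; ring.
  rewrite lerXn2r ?nnegrE ?nc_ge0 ?expR_ge0 //.
  by apply: le_trans psik _; exact: expR_ge1Dx.
rewrite sumr_const_nat -[leLHS]mulr_natl ler_wpM2r ?expR_ge0 // ler_nat leq_subr //.
Qed.

Lemma harmonic_le (K : nat) : (0 < K)%N ->
  \sum_(d < K) (d.+1%:R^-1 : R) <= 1 + ln K%:R.
Proof.
case: K => // K _; elim: K => [|K IH].
  by rewrite big_ord_recl big_ord0 ln1 invr1 /= !addr0.
rewrite big_ord_recr /=; apply: le_trans (lerD IH (lexx _)) _.
have K0 : 0 < K.+1%:R :> R by rewrite ltr0n.
have K1 : 0 < K.+2%:R :> R by rewrite ltr0n.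
have : ln (1 + (- K.+2%:R^-1)) <= - K.+2%:R^-1 :> R.
  apply: le_ln1Dx; rewrite ltrNl opprK invf_lt1 // ltr1n //.
have split1 (x : R) : 0 < x + 1 -> 1 + - (x + 1)^-1 = x / (x + 1).
  by move=> x0; field; rewrite lt0r_neq0.
have -> : 1 + - K.+2%:R^-1 = K.+1%:R / K.+2%:R :> R.
  by rewrite -[K.+2%:R]natr1 split1 // natr1.
rewrite ln_div ?posrE //.
move: (ln K.+1%:R) (ln K.+2%:R) K.+2%:R^-1 => u v w; lra.
Qed.

(** Three ranges give the three terms: d = 0 by the number of times, d omega <= 1 / M by the drift
    bound (a harmonic sum), and the rest by the gap kappa. *)
Lemma sum_char_geom m M kappa omega K n0 n1 :
  0 < m -> 0 < M -> (forall i, m <= z i) -> (forall i, z i <= M) -> (n0 <= n1)%N ->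
  (0 < K)%N -> 0 < omega ->
  (forall theta, M^-1 <= theta -> theta <= K%:R * omega ->
     nc (psi theta) <= 1 - kappa) ->
  \sum_(d < K) nc (Psi n0 n1 (d%:R * omega)) <=
  n1%:R + 4 / (m * omega) * (1 + ln K%:R) +
  K%:R * (n1%:R * expR (- (kappa * n0%:R))).
Proof.
move=> m0 M0 zm zM n01 K0 w0 psik.
have e0 : 0 <= n1%:R * expR (- (kappa * n0%:R)) by rewrite mulr_ge0 // expR_ge0.
case: K K0 psik => // K _ psik; rewrite big_ord_recl /=.
have c0 : 0 < 4 / (m * omega) by rewrite divr_gt0 // mulr_gt0.
rewrite -addrA; apply: lerD; first exact: nc_char_geom_le.
apply: (@le_trans _ _ (\sum_(d < K) (4 / (m * omega) * d.+1%:R^-1 +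
    n1%:R * expR (- (kappa * n0%:R))))).
  apply: ler_sum => d _; rewrite /bump /= add1n.
  have d0 : 0 < d.+1%:R :> R by rewrite ltr0n.
  have [dM|Md] := leP (d.+1%:R * omega) M^-1.
    apply: (@le_trans _ _ (4 / (m * (d.+1%:R * omega)))).
      apply: (nc_char_geom_small (M := M)) => //; first by rewrite mulr_gt0.
      by rewrite -ler_pdivlMr // div1r.
    have -> : 4 / (m * (d.+1%:R * omega)) = 4 / (m * omega) * d.+1%:R^-1.
      by field; rewrite !lt0r_neq0.
    by rewrite lerDl.
  apply: le_trans (nc_char_geom_decay _ _ (psik _ (ltW Md) _)) _.
    by rewrite ler_wpM2r ?(ltW w0) // ler_nat; exact: leqW (ltn_ord d).
  by rewrite lerDr mulr_ge0 ?(ltW c0) // invr_ge0.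
rewrite big_split /= -mulr_sumr; apply: lerD.
  rewrite ler_wpM2l ?(ltW c0) //; apply: le_trans (harmonic_le (ltn0Sn K)).
  by rewrite big_ord_recr /= lerDl invr_ge0.
by rewrite sumr_const card_ord -[leLHS]mulr_natl ler_wpM2r // ler_nat.
Qed.

End CharGeomBounds.

(** If both sines are small, theta a and theta b are close to p pi and n pi, so n (a / b) is close
    to p with n = O(Theta). The Diophantine bound keeps this distance above a multiple of n ^ (1 -
    l). *)
Lemma diophantine_sin (R : realType) (l a b theta0 : R) : 1 <= l -> 0 < a -> 0 < b ->
  0 < theta0 -> non_liouville l (a / b) ->
  exists2 c : R, 0 < c & forall Theta theta beta : R, 1 <= Theta ->
    theta0 <= theta <= Theta ->
    `|sin (theta * a)| <= beta -> `|sin (theta * b)| <= beta ->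
    c * Theta `^ (1 - l) <= beta.
Proof.
move=> l1 a0 b0 t00 [c1 c10 hc1].
have tau0 : 0 < a / b by rewrite divr_gt0.
set tau := a / b in hc1 tau0.
have pi1 : 1 <= pi :> R by apply: le_trans (@pi_ge2 R); rewrite ler1n.
pose c2 := c1 * (b + 4) `^ (1 - l) / (4 * (1 + tau)).
have b4 : 0 < b + 4 by lra.
have c20 : 0 < c2 by rewrite divr_gt0 ?mulr_gt0 ?powR_gt0 //; lra.
(* The three entries serve the cases beta >= 1, n <= 0 (where theta >= theta0 makes theta b far from
   n pi), and n >= 1. *)
pose c := Num.min 1 (Num.min (theta0 * b / 4) c2).
have c_1 : c <= 1 by rewrite /c ge_min lexx.
have c_2 : c <= theta0 * b / 4 by rewrite /c !ge_min lexx orbT.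
have c_3 : c <= c2 by rewrite /c !ge_min lexx !orbT.
have c_0 : 0 < c by rewrite /c !lt_min ltr01 c20 divr_gt0 ?mulr_gt0.
exists c => // Theta theta beta T1 /andP[t0t tT] sa sb.
have T0 : 0 < Theta by lra.
have TP1 : Theta `^ (1 - l) <= 1.
  by rewrite -[leRHS](powRr0 Theta) ler_powR // subr_le0.
have TP0 := powR_gt0 (1 - l) T0.
have beta0 : 0 <= beta by apply: le_trans sa.
have [b1|b1] := leP 1 beta; first by nra.
have [p hp] := near_pi_multiple (theta * a).
have [n hn] := near_pi_multiple (theta * b).
have hp' : `|theta * a - p%:~R * pi| <= 4 * beta by lra.
have hn' : `|theta * b - n%:~R * pi| <= 4 * beta by lra.
have [n_le0|n_gt0] := leP n 0.
  have : n%:~R <= 0 :> R by rewrite lerz0.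
  move: hn'; rewrite ler_norml => /andP[_ h1] h2.
  have : theta0 * b <= 4 * beta by nra.
  by nra.
case: n n_gt0 hn hn' => // n n0 hn hn'.
have n0' : (0 < n)%N by [].
have n0R : 0 < n%:R :> R by rewrite ltr0n.
have nE : (Posz n)%:~R = n%:R :> R by [].
rewrite nE in hn hn'.
have nT : n%:R <= Theta * (b + 4).
  move: hn'; rewrite ler_norml => /andP[h1 _]; nra.
have key : c1 * n%:R `^ (1 - l) <= 4 * beta * (1 + tau).
  have h := hc1 p n n0'.
  have : c1 / (n%:R `^ l) * n%:R <= `|n%:R * tau - p%:~R|.
    have -> : n%:R * tau - p%:~R = (tau - p%:~R / n%:R) * n%:R.
      by field; rewrite lt0r_neq0.
    by rewrite normrM (gtr0_norm n0R) ler_wpM2r // ltW.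
  have -> : c1 / (n%:R `^ l) * n%:R = c1 * n%:R `^ (1 - l).
    rewrite powRB ?lt0r_neq0 ?implybT // powRr1 ?ltW //; ring.
  move=> h1; apply: (le_trans h1).
  have aE : a = tau * b by rewrite /tau divfK // lt0r_neq0.
  have e : pi * (n%:R * tau - p%:~R) =
     (theta * a - p%:~R * pi) - tau * (theta * b - n%:R * pi).
    by rewrite aE; ring.
  have : `|pi * (n%:R * tau - p%:~R)| <= 4 * beta * (1 + tau).
    rewrite e; apply: le_trans (ler_normB _ _) _.
    rewrite normrM (gtr0_norm tau0); nra.
  rewrite normrM gtr0_norm ?(lt_le_trans ltr01) // => h2.
  have := normr_ge0 (n%:R * tau - p%:~R); nra.
have nP : (Theta * (b + 4)) `^ (1 - l) <= n%:R `^ (1 - l).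
  have -> : 1 - l = - (l - 1) by ring.
  rewrite !powRN lef_pV2 ?posrE ?powR_gt0 ?mulr_gt0 //.
  by rewrite ge0_ler_powR ?nnegrE ?subr_ge0 // ltW // mulr_gt0.
rewrite (powRM _ (ltW T0) (ltW b4)) in nP.
apply: (@le_trans _ _ (c2 * Theta `^ (1 - l))); first by rewrite ler_wpM2r // ltW.
have d0 : 0 < 4 * (1 + tau) by lra.
rewrite /c2 mulrAC ler_pdivrMr //.
apply: (@le_trans _ _ (c1 * n%:R `^ (1 - l))).
  rewrite -mulrA ler_wpM2l ?(ltW c10) //; apply: le_trans nP.
  by rewrite mulrC.
by apply: (le_trans key); rewrite mulrA (mulrC beta).
Qed.

(** * Energy along the walk, and the walk with doubled steps *)

Section WalkEnergy.
Context (R : realType) (I : finType) (q z : I -> R) (E : R -> R) (m M : R).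
Local Notation nc := (@Normc.normc R).
Hypothesis q_ge0 : forall i, 0 <= q i.
Hypothesis q_sum1 : \sum_i q i = 1.
Hypothesis M_gt0 : 0 < M.
Hypothesis zm : forall i, m <= z i.
Hypothesis zM : forall i, z i <= M.
Hypothesis E_ge0 : forall u, 0 <= E u.
Hypothesis E_lip : forall u v, E u <= E v + 4 * `|u - v|.
Hypothesis E_sub : forall u, E u <= \sum_i q i * E (u * expR (- z i)).

(* The windows in s are cut along the arithmetic progression of step h in the
   frequency variable expR (L - s). *)
Lemma window_cover (L t h : R) (j0 N : nat) (s : R) :
  0 < h -> (0 < j0)%N ->
  j0%:R * h <= expR (L - t - M) -> expR (L - t) < N%:R * h ->
  E (expR (L - s)) * (t <= s <= t + M)%R%:R <=
  \sum_(j < N) (E (j%:R * h) + 4 * h) *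
    (L - ln (j.+1%:R * h) <= s <= L - ln (j.+1%:R * h) + j0%:R^-1)%R%:R.
Proof.
move=> h0 j00 hj0 hN.
have term0 j : 0 <= (E (j%:R * h) + 4 * h) *
    (L - ln (j.+1%:R * h) <= s <= L - ln (j.+1%:R * h) + j0%:R^-1)%R%:R.
  by rewrite mulr_ge0 // addr_ge0 // mulr_ge0 // ltW.
have [/andP[ts sM]|_] := boolP (t <= s <= t + M); last first.
  by rewrite mulr0; apply: sumr_ge0 => j _.
rewrite mulr1; set u := expR (L - s).
have u0 : 0 < u by exact: expR_gt0.
have u_ge : expR (L - t - M) <= u by rewrite ler_expR; lra.
have u_le : u <= expR (L - t) by rewrite ler_expR; lra.
have uh0 : 0 <= u / h by rewrite divr_ge0 // ltW.
pose j := Num.truncn (u / h).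
have /andP[j1 j2] : j%:R <= u / h < j.+1%:R by exact: truncn_itv.
have j1' : j%:R * h <= u by rewrite -ler_pdivlMr.
have j2' : u < j.+1%:R * h by rewrite -ltr_pdivrMr.
have jN : (j < N)%N.
  by rewrite -(ltr_nat R) -(ltr_pM2r h0) (le_lt_trans j1') // (le_lt_trans u_le).
have j0j : (j0 <= j)%N.
  rewrite -ltnS -(ltr_nat R) -(ltr_pM2r h0).
  by apply: le_lt_trans j2'; apply: le_trans u_ge.
rewrite (bigD1 (Ordinal jN)) //=.
apply: (@le_trans _ _ (E (j%:R * h) + 4 * h)).
  apply: le_trans (E_lip u (j%:R * h)) _; rewrite lerD2l ler_wpM2l //.
  rewrite ger0_norm; last by rewrite subr_ge0.
  by move: j2'; rewrite -natr1; lra.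
have -> : L - ln (j.+1%:R * h) <= s <= L - ln (j.+1%:R * h) + j0%:R^-1.
  have lu : ln u = L - s by rewrite expRK.
  have jh0 : 0 < j.+1%:R * h by rewrite mulr_gt0 // ltr0n.
  have h1 : ln u <= ln (j.+1%:R * h) by rewrite ler_ln ?posrE // ltW.
  have j0' : 0 < j%:R :> R by rewrite ltr0n (leq_trans j00).
  (* The frequency cell between j h and (j + 1) h has logarithmic length ln (1 + 1 / j), at most 1 /
     j0 since j >= j0. *)
  have h2 : ln (j.+1%:R * h) <= ln u + j0%:R^-1.
    have -> : j.+1%:R * h = (1 + j%:R^-1) * (j%:R * h).
      by rewrite -natr1; field; rewrite lt0r_neq0.
    rewrite lnM ?posrE ?addr_gt0 ?invr_gt0 ?mulr_gt0 // addrC; apply: lerD.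
      by rewrite ler_ln ?posrE ?mulr_gt0.
    apply: (@le_trans _ _ (j%:R^-1)).
      by apply: le_ln1Dx; apply: lt_trans (_ : 0 < _); rewrite ?ltrN10 ?invr_gt0.
    by rewrite lef_pV2 ?posrE ?ler_nat ?ltr0n // (leq_trans j00).
  by apply/andP; split; lra.
by rewrite mulr1 lerDl; apply: sumr_ge0 => i _.
Qed.

(** s -> E(exp (L - s)) is subharmonic for the walk, so [hitting] applies. All cells of
    [window_cover] have the same width 1 / j0, hence a common occupation bound; K omega <= j0 is the
    width condition of [occupation_cell]. *)
Lemma walk_energy_bound (L t h omega : R) (j0 N K n0 n1 : nat) :
  0 < h -> (0 < j0)%N ->
  j0%:R * h <= expR (L - t - M) -> expR (L - t) < N%:R * h ->
  (0 < K)%N -> 0 <= omega -> K%:R * omega <= j0%:R ->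
  0 < t -> n0%:R * M <= t -> t <= n1%:R * m ->
  E (expR L) <= 8 / K%:R * (\sum_(d < K) nc (char_geom q z n0 n1.+1 (d%:R * omega))) *
    (\sum_(j < N) E (j%:R * h) + N%:R * (4 * h)).
Proof.
move=> h0 j00 hj0 hN K0 w0 Kj t0 n0t n1t.
pose g s := E (expR (L - s)).
have g_sub s : g s <= walk_step q z g s.
  apply: le_trans (E_sub _) _; apply: ler_sum => i _.
  rewrite /g -expRD ler_wpM2l //; rewrite (_ : L - s + - z i = L - (s + z i)) //.
  by ring.
have := hitting q_ge0 q_sum1 zm zM (fun s => E_ge0 _) g_sub M_gt0 t0 n0t n1t.
rewrite subr0 => h1; apply: (le_trans h1).
pose cell (j : 'I_N) (s : R) : R :=
  (L - ln (j.+1%:R * h) <= s <= L - ln (j.+1%:R * h) + j0%:R^-1)%R%:R.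
apply: (@le_trans _ _ (occupation q z n0 n1.+1
    (fun s => \sum_(j < N) (E (j%:R * h) + 4 * h) * cell j s))).
  by apply: occupation_le => // s; exact: window_cover.
rewrite occupation_sum.
set B := 8 / K%:R * _.
have -> : B * (\sum_(j < N) E (j%:R * h) + N%:R * (4 * h)) =
    \sum_(j < N) (E (j%:R * h) + 4 * h) * B.
  by rewrite -mulr_suml mulrC big_split /= sumr_const card_ord mulr_natl.
apply: ler_sum => j _; apply: ler_wpM2l.
  by rewrite addr_ge0 // mulr_ge0 // ltW.
apply: occupation_cell => //; rewrite ler_pdivrMr ?ltr0n // mul1r //.
Qed.

End WalkEnergy.

(* Making one or two steps with probability 1/2 each turns the characteristic
   function phi into phi (1 + phi) / 2, so that its modulus is close to 1 only
   where phi is close to 1.  With single steps it would have modulus 1 at some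
   theta <> 0 as soon as the lengths x w lie in a progression a + b Z. *)
Section DoubledWalk.
Context (R : realType) (A : finType) (p x : A -> R).
Local Notation nc := (@Normc.normc R).
Hypothesis p_ge0 : forall w, 0 <= p w.
Hypothesis p_sum1 : \sum_w p w = 1.

Definition dbl_weight (i : A + A * A) : R :=
  match i with inl w => p w / 2 | inr (w, v) => p w * p v / 2 end.

Definition dbl_length (i : A + A * A) : R :=
  match i with inl w => x w | inr (w, v) => x w + x v end.

Lemma dbl_weight_ge0 i : 0 <= dbl_weight i.
Proof. by case: i => [w|[w v]] /=; rewrite ?divr_ge0 ?mulr_ge0. Qed.

Lemma sum_dbl (V : nmodType) (f : A + A * A -> V) :
  \sum_i f i = \sum_w f (inl w) + \sum_w \sum_v f (inr (w, v)).
Proof.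
rewrite big_sumType /=; congr (_ + _).
by rewrite pair_bigA /=; apply: eq_bigr => -[].
Qed.

Lemma dbl_weight_sum1 : \sum_i dbl_weight i = 1.
Proof.
rewrite sum_dbl /=.
have -> : \sum_w \sum_v p w * p v / 2 = 1 / 2.
  rewrite -[in RHS]p_sum1 mulr_suml; apply: eq_bigr => w _.
  by rewrite -mulr_suml -mulr_sumr p_sum1 mulr1.
by rewrite -mulr_suml p_sum1; lra.
Qed.

Lemma dbl_subharmonic (E : R -> R) (u : R) :
  (forall u, E u <= \sum_w p w * E (u * expR (- x w))) ->
  E u <= \sum_i dbl_weight i * E (u * expR (- dbl_length i)).
Proof.
move=> E_sub; rewrite sum_dbl /=.
have h1 := E_sub u.
have h2 : E u <= \sum_w \sum_v p w * p v * E (u * expR (- (x w + x v))).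
  apply: (le_trans h1); apply: ler_sum => w _.
  rewrite (eq_bigr (fun v => p w * (p v * E (u * expR (- x w) * expR (- x v))))).
    by rewrite -mulr_sumr ler_wpM2l.
  by move=> v _; rewrite opprD expRD !mulrA.
have -> : \sum_w p w / 2 * E (u * expR (- x w)) = (\sum_w p w * E (u * expR (- x w))) / 2.
  by rewrite mulr_suml; apply: eq_bigr => w _; ring.
have -> : \sum_w \sum_v p w * p v / 2 * E (u * expR (- (x w + x v))) =
    (\sum_w \sum_v p w * p v * E (u * expR (- (x w + x v)))) / 2.
  rewrite mulr_suml; apply: eq_bigr => w _; rewrite mulr_suml.
  by apply: eq_bigr => v _; ring.
lra.
Qed.

Lemma dbl_char_fun theta :
  char_fun dbl_weight dbl_length theta =
  (2^-1)%:C%C * (char_fun p x theta * (1 + char_fun p x theta)).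
Proof.
rewrite {1}/char_fun sum_dbl /= mulrDr mulr1 mulrDr; congr (_ + _).
  rewrite /char_fun mulr_sumr; apply: eq_bigr => w _.
  by rewrite rmorphM /=; ring.
rewrite /char_fun mulr_suml mulr_sumr; apply: eq_bigr => w _.
rewrite !mulr_sumr; apply: eq_bigr => v _.
by rewrite !rmorphM /= mulrDr cisD; ring.
Qed.

Lemma nc_1cis (t : R) : nc (1 + cis t) = 2 * `|cos (t / 2)|.
Proof.
have -> : 1 + cis t = cis (t / 2) * (2 * cos (t / 2))%:C%C.
  rewrite {1}(_ : t = t / 2 + t / 2); last by field.
  rewrite cisD /cis; set c := cos _; set s := sin _.
  have cs : c ^+ 2 + s ^+ 2 = 1 by exact: cos2Dsin2.
  apply/eqP; rewrite eq_complex /=; apply/andP; split; apply/eqP.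
    by rewrite expr2 expr2 in cs; lra.
  by ring.
by rewrite Normc.normcM nc_cis nc_real mul1r normrM ger0_norm.
Qed.

(** |1 + exp (i t)| = 2 |cos (t / 2)|, and 2 - 2 |cos| >= sin ^ 2 for one chosen w; the other terms
    are bounded trivially. *)
Lemma nc_dbl_char_fun theta w :
  nc (char_fun dbl_weight dbl_length theta) <=
  1 - p w / 2 * sin (theta * (x w / 2)) ^+ 2.
Proof.
rewrite dbl_char_fun !Normc.normcM nc_real ger0_norm //.
have c1 := nc_char_fun_le1 x p_ge0 p_sum1 theta.
have c0 := nc_ge0 (char_fun p x theta).
have k : nc (1 + char_fun p x theta) <= \sum_v p v * (2 * `|cos (theta * (x v / 2))|).
  have -> : 1 + char_fun p x theta = \sum_v (p v)%:C%C * (1 + cis (theta * x v)).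
    under [RHS]eq_bigr do rewrite mulrDr mulr1.
    by rewrite big_split /= -rmorph_sum p_sum1.
  apply: le_trans (nc_sum _ _ _) _; apply: ler_sum => v _.
  rewrite Normc.normcM nc_real ger0_norm // nc_1cis.
  by rewrite (_ : theta * x v / 2 = theta * (x v / 2)) // mulrA.
have k2 : \sum_v p v * (2 * `|cos (theta * (x v / 2))|) <=
    2 - p w * sin (theta * (x w / 2)) ^+ 2.
  have -> : 2 - p w * sin (theta * (x w / 2)) ^+ 2 =
     \sum_v p v * 2 - p w * sin (theta * (x w / 2)) ^+ 2.
    by rewrite -mulr_suml p_sum1 mul1r.
  rewrite (bigD1 w) //= [in leRHS](bigD1 w) //= addrAC; apply: lerD.
    have cs := cos2Dsin2 (theta * (x w / 2)).
    have cm := cos_max (theta * (x w / 2)).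
    have cn := normr_ge0 (cos (theta * (x w / 2))).
    have c2 : `|cos (theta * (x w / 2))| ^+ 2 = cos (theta * (x w / 2)) ^+ 2.
      by rewrite real_normK ?num_real.
    rewrite -mulrBr ler_wpM2l //; nra.
  apply: ler_sum => v _; rewrite ler_wpM2l //.
  by have := cos_max (theta * (x v / 2)); lra.
have := nc_ge0 (1 + char_fun p x theta).
have : nc (char_fun p x theta) * nc (1 + char_fun p x theta) <= nc (1 + char_fun p x theta).
  by rewrite ler_piMl // nc_ge0.
move=> h1 h2; lra.
Qed.

End DoubledWalk.

(** [nc_dbl_char_fun] is used at j or at k, whichever sine is larger; the half-lengths have the same
    ratio as the lengths. Squaring the sine doubles the exponent l - 1. *)
Lemma dbl_char_decay (R : realType) (A : finType) (p x : A -> R) (l theta0 : R) (j k : A) :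
  (forall w, 0 < p w) -> \sum_w p w = 1 -> (forall w, 0 < x w) ->
  1 <= l -> 0 < theta0 -> non_liouville l (x j / x k) ->
  exists2 kappa : R, 0 < kappa & forall Theta theta : R, 1 <= Theta ->
    theta0 <= theta <= Theta ->
    Normc.normc (char_fun (dbl_weight p) (dbl_length x) theta) <=
    1 - kappa * Theta `^ (- (2 * (l - 1))).
Proof.
move=> p0 p1 x0 l1 t0 hjk.
have hjk' : non_liouville l ((x j / 2) / (x k / 2)).
  rewrite (_ : x j / 2 / (x k / 2) = x j / x k) //.
  by field; rewrite lt0r_neq0.
have [c c0 hc] := diophantine_sin l1 (divr_gt0 (x0 j) (ltr0n _ 2)) (divr_gt0 (x0 k) (ltr0n _ 2)) t0 hjk'.
pose p_ := Num.min (p j) (p k).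
have p_0 : 0 < p_ by rewrite lt_min !p0.
have p_j : p_ <= p j by rewrite ge_min lexx.
have p_k : p_ <= p k by rewrite ge_min lexx orbT.
exists (p_ / 2 * c ^+ 2) => [|Theta theta T1 tt]; first by rewrite mulr_gt0 ?divr_gt0 ?exprn_gt0.
have T0 : 0 < Theta by lra.
have -> : Theta `^ (- (2 * (l - 1))) = (Theta `^ (1 - l)) ^+ 2.
  by rewrite -powR_mulrn ?powR_ge0 // -powRrM; congr powR; ring.
set sj := sin (theta * (x j / 2)); set sk := sin (theta * (x k / 2)).
have h := hc Theta theta (Num.max `|sj| `|sk|) T1 tt.
have {}h : c * Theta `^ (1 - l) <= Num.max `|sj| `|sk|.
  by apply: h; rewrite le_max lexx ?orbT.
have pw0 w : 0 <= p w by exact: ltW.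
have T2 : 0 <= c * Theta `^ (1 - l) by rewrite mulr_ge0 ?powR_ge0 // ltW.
have fin (w : A) (sw : R) : sw = sin (theta * (x w / 2)) -> p_ <= p w -> c * Theta `^ (1 - l) <= `|sw| ->
    Normc.normc (char_fun (dbl_weight p) (dbl_length x) theta) <=
    1 - p_ / 2 * c ^+ 2 * (Theta `^ (1 - l)) ^+ 2.
  move=> -> pw hw; apply: le_trans (nc_dbl_char_fun x pw0 p1 theta w) _.
  rewrite lerB // -mulrA -exprMn.
  have h2 : (c * Theta `^ (1 - l)) ^+ 2 <= sin (theta * (x w / 2)) ^+ 2.
    by rewrite -[leRHS]real_normK ?num_real // lerXn2r ?nnegrE.
  apply: ler_pM => //; rewrite ?sqr_ge0 ?divr_ge0 ?(ltW p_0) //.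
  by rewrite ler_wpM2r.
move: h; rewrite le_max => /orP[h|h]; [exact: (fin j sj)|exact: (fin k sk)].
Qed.

(** Used at y = sqrt L, where y ^ 6 = L ^ 3 absorbs the number of frequencies (at most L ^ 2) times
    the number of times (O(L)). *)
Lemma pow6_expR (R : realType) (kappa y : R) : 0 < kappa -> 0 <= y ->
  y ^+ 6 * expR (- (kappa * y)) <= (6 / kappa) ^+ 6.
Proof.
move=> k0 y0.
have -> : expR (- (kappa * y)) = expR (- (kappa * y / 6)) ^+ 6.
  by rewrite -expRM_natl; congr expR; field.
rewrite -exprMn lerXn2r ?nnegrE ?mulr_ge0 ?expR_ge0 ?invr_ge0 ?(ltW k0) //.
rewrite expRN ler_pdivrMr ?expR_gt0 //.
have := expR_ge1Dx (kappa * y / 6) => h.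
apply: (@le_trans _ _ (6 / kappa * (kappa * y / 6))).
  by rewrite le_eqVlt; apply/orP; left; apply/eqP; field; rewrite lt0r_neq0.
by rewrite ler_wpM2l ?divr_ge0 ?(ltW k0) //; lra.
Qed.

(** * Choice of parameters and logarithmic decay of the energy *)

Section LogDecay.
Context (R : realType) (I : finType) (q z : I -> R) (E : R -> R) (m M : R).
Local Notation nc := (@Normc.normc R).
Hypothesis q_ge0 : forall i, 0 <= q i.
Hypothesis q_sum1 : \sum_i q i = 1.
Hypothesis m_gt0 : 0 < m.
Hypothesis M_gt0 : 0 < M.
Hypothesis zm : forall i, m <= z i.
Hypothesis zM : forall i, z i <= M.
Hypothesis E_ge0 : forall u, 0 <= E u.
Hypothesis E_lip : forall u v, E u <= E v + 4 * `|u - v|.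
Hypothesis E_sub : forall u, E u <= \sum_i q i * E (u * expR (- z i)).
Variables (c s l kappa0 : R).
Hypothesis c_gt0 : 0 < c.
Hypothesis s_gt0 : 0 < s.
Hypothesis l_ge2 : 2 <= l.
Hypothesis kappa0_gt0 : 0 < kappa0.
Hypothesis E_avg : forall (h rho : R) (N : nat), 0 < h <= 1 -> 0 < rho ->
  \sum_(j < N) E (j%:R * h) <= N%:R * (c * rho `^ s) + 4 / (h * rho).
Hypothesis decay : forall Theta theta : R, 1 <= Theta ->
  M^-1 <= theta <= Theta ->
  nc (char_fun q z theta) <= 1 - kappa0 * Theta `^ (- (2 * (l - 1))).

(** The frequency step will be h = L ^ (- a), and [e] places the window by L - t = e ln L. As a + e
    = 1 / D, its top frequency exp (L - t) = L ^ e is T h with T = L ^ (1 / D). Solving h = rho ^ s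
    and T h ^ 2 rho = 1 gives a. *)
Let D := 4 * (l - 1).
Let S := 1 + 2 * s.
Let a := s / (S * D).
Let e := (1 + s) / (S * D).

Let D_ge4 : 4 <= D. Proof. by have := l_ge2; rewrite /D; lra. Qed.
Let D_gt0 : 0 < D. Proof. exact: lt_le_trans D_ge4. Qed.
Let S_gt0 : 0 < S. Proof. by have := s_gt0; rewrite /S; lra. Qed.
Let SD_gt0 : 0 < S * D. Proof. exact: mulr_gt0. Qed.
Let a_gt0 : 0 < a. Proof. exact: divr_gt0. Qed.
Let e_gt0 : 0 < e. Proof. by rewrite divr_gt0 // addr_gt0. Qed.
Let e_le1 : e <= 1.
Proof. by rewrite ler_pdivrMr // mul1r /S; have := D_ge4; have := s_gt0; nra. Qed.
Let aeD : a + e = D^-1.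
Proof. by rewrite /a /e /S; field; rewrite !lt0r_neq0. Qed.

Let kappa1 := kappa0 / (4 * M).
Let C1 := 4 / m + 8 / m + 6 + (m^-1 + 3) * (6 / kappa1) ^+ 6.

Let kappa1_gt0 : 0 < kappa1. Proof. by rewrite divr_gt0 // mulr_gt0. Qed.

Let ln_leid (L : R) : 1 <= L -> 0 <= ln L /\ ln L <= L.
Proof.
move=> L1; split; first exact: ln_ge0.
have h : ln (1 + (L - 1)) <= L - 1 by apply: le_ln1Dx; lra.
by rewrite (_ : 1 + (L - 1) = L) in h; [lra|ring].
Qed.

(** With omega = 1 / L and K about L j0, frequencies stay below T. The zero frequency costs O(L),
    the low ones O(L (1 + ln L)), and the remaining ones O(1). *)
Lemma geom_sum_le (L t T : R) (j0 : nat) :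
  2 <= L -> 8 * M <= L -> T = L `^ D^-1 ->
  (0 < j0)%N -> j0%:R <= T -> L / 2 <= t -> t <= L ->
  \sum_(d < Num.truncn (L * j0%:R)) nc (char_geom q z (Num.truncn (t / M))
     (Num.truncn (t / m)).+2 (d%:R * L^-1)) <= C1 * L * (1 + ln L).
Proof.
move=> L2 LM TE j00 j0T tL1 tL2.
have D4 := D_ge4; have m0 := m_gt0; have M0 := M_gt0; have l2 := l_ge2.
have L1 : 1 <= L by lra.
have L0 : 0 < L by lra.
have [ln0 lnL] := ln_leid L1.
have j01 : 1 <= j0%:R :> R by rewrite ler1n.
have T1 : 1 <= T by lra.
have TL : T <= L.
  rewrite TE -[leRHS]powRr1 ?(ltW L0) // ler_powR // invf_le1 //; lra.
set K := Num.truncn (L * j0%:R).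
set n0 := Num.truncn (t / M).
set n1 := Num.truncn (t / m).
have Lj0 : 0 <= L * j0%:R by nra.
have /andP[K1 K2] : K%:R <= L * j0%:R < K.+1%:R by exact: truncn_itv.
have t0 : 0 <= t by lra.
have /andP[n01 n02] : n0%:R <= t / M < n0.+1%:R by apply: truncn_itv; rewrite divr_ge0 // ltW.
have /andP[n11 n12] : n1%:R <= t / m < n1.+1%:R by apply: truncn_itv; rewrite divr_ge0 // ltW.
have Kpos : (0 < K)%N.
  rewrite lt0n; apply/eqP => K0; move: K2; rewrite K0 => K2.
  have : 2 <= L * j0%:R by nra.
  by lra.
have KR : 1 <= K%:R :> R by rewrite ler1n.
have mM : m <= M.
  have [i _] : exists i : I, True.
    have : \sum_i q i != 0 by rewrite q_sum1 oner_neq0.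
    case: (pickP I) => [i _|I0]; first by exists i.
    by rewrite big_pred0 ?eqxx.
  exact: le_trans (zm i) (zM i).
have n0n1 : (n0 <= n1.+2)%N.
  have : n0%:R < n1.+1%:R :> R.
    apply: le_lt_trans n01 _; apply: le_lt_trans n12.
    by rewrite ler_wpM2l // lef_pV2.
  by rewrite ltr_nat => h; exact: leqW (ltnW h).
set kappa := kappa0 * T `^ (- (2 * (l - 1))).
have kE : kappa = kappa0 * L `^ (- 2^-1).
  rewrite /kappa TE -powRrM; congr (_ * powR _ _).
  by rewrite /D; field; apply/eqP; lra.
have KT : K%:R * L^-1 <= T.
  rewrite ler_pdivrMr //; apply: le_trans K1 _.
  by rewrite mulrC ler_wpM2r // ltW.
have hs := @sum_char_geom R I q z q_ge0 q_sum1 m M kappa L^-1 K n0 n1.+2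
  m_gt0 M_gt0 zm zM n0n1 Kpos.
apply: le_trans (hs _ _) _; first by rewrite invr_gt0.
  move=> theta th1 th2; apply: decay => //.
  by rewrite th1 (le_trans th2).
have n1L : n1.+2%:R <= (m^-1 + 3) * L.
  have : t / m <= L / m by rewrite ler_wpM2r // invr_ge0 ltW.
  rewrite -(natr1 _) -(natr1 n1); move: n11 => + h; lra.
have lnK : ln K%:R <= 2 * ln L.
  have -> : 2 * ln L = ln (L * L) by rewrite lnM ?posrE //; ring.
  rewrite ler_ln ?posrE ?mulr_gt0 //; last by lra.
  by apply: le_trans K1 _; rewrite ler_wpM2l ?(ltW L0) // (le_trans j0T).
have expo : kappa1 * L `^ 2^-1 <= kappa * n0%:R.
  (* t / M is at least L / (2 M), and L >= 8 M leaves room for rounding down. *)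
  have n0L : L / (4 * M) <= n0%:R.
    have h1 : L / 2 / M <= t / M by rewrite ler_wpM2r // invr_ge0 ltW.
    have h2 : 2 <= L / (4 * M) by rewrite ler_pdivlMr ?mulr_gt0 //; lra.
    have h3 : L / 2 / M = 2 * (L / (4 * M)) by field; rewrite lt0r_neq0.
    by move: n02; rewrite -natr1; lra.
  have LE : L `^ 2^-1 = L `^ (- 2^-1) * L.
    rewrite -[X in _ * X]powRr1 ?(ltW L0) // -powRD; first by congr powR; field.
    by rewrite lt0r_neq0 // implybT.
  rewrite kE LE (_ : kappa1 * _ = kappa0 * L `^ (- 2^-1) * (L / (4 * M))).
    by rewrite ler_wpM2l // mulr_ge0 ?powR_ge0 // ltW.
  by rewrite /kappa1; field; rewrite lt0r_neq0.
have small : K%:R * (n1.+2%:R * expR (- (kappa * n0%:R))) <= (m^-1 + 3) * (6 / kappa1) ^+ 6.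
  have p6 := pow6_expR kappa1_gt0 (powR_ge0 L 2^-1).
  have L3 : (L `^ 2^-1) ^+ 6 = L ^+ 3.
    rewrite -powR_mulrn ?powR_ge0 // -powRrM (_ : 2^-1 * 6%:R = 3%:R).
      by rewrite powR_mulrn // ltW.
    by field.
  rewrite L3 in p6.
  have KL : K%:R <= L ^+ 2.
    by apply: le_trans K1 _; rewrite expr2 ler_wpM2l ?(ltW L0) // (le_trans j0T).
  have ee : expR (- (kappa * n0%:R)) <= expR (- (kappa1 * L `^ 2^-1)).
    by rewrite ler_expR lerN2.
  have e0 := expR_ge0 (- (kappa * n0%:R)).
  have m3 : 0 <= m^-1 + 3 by rewrite addr_ge0 // invr_ge0 ltW.
  apply: (@le_trans _ _ (L ^+ 2 * ((m^-1 + 3) * L * expR (- (kappa1 * L `^ 2^-1))))).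
    have le1 : n1.+2%:R * expR (- (kappa * n0%:R)) <=
        (m^-1 + 3) * L * expR (- (kappa1 * L `^ 2^-1)) by exact: ler_pM.
    by apply: ler_pM => //; rewrite mulr_ge0.
  rewrite [leLHS](_ : _ = (m^-1 + 3) * (L ^+ 3 * expR (- (kappa1 * L `^ 2^-1)))).
    by rewrite ler_wpM2l.
  by ring.
have lL : L <= L * (1 + ln L) by rewrite ler_pMr //; lra.
have h3 : 4 / (m * L^-1) * (1 + ln K%:R) <= 8 / m * (L * (1 + ln L)).
  have -> : 4 / (m * L^-1) = 4 / m * L by field; rewrite !lt0r_neq0.
  have -> : 8 / m * (L * (1 + ln L)) = 4 / m * L * (2 * (1 + ln L)).
    by field; rewrite lt0r_neq0.
  rewrite ler_wpM2l ?mulr_ge0 ?invr_ge0 ?(ltW m0) ?(ltW L0) //; lra.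
have mi : 0 < m^-1 by rewrite invr_gt0.
have h4 : n1.+2%:R <= (m^-1 + 3) * (L * (1 + ln L)).
  by apply: le_trans n1L _; rewrite ler_wpM2l //; lra.
have h5 : (m^-1 + 3) * (6 / kappa1) ^+ 6 <= (m^-1 + 3) * (6 / kappa1) ^+ 6 * (L * (1 + ln L)).
  rewrite ler_peMr //; last by lra.
  apply: mulr_ge0; first by rewrite addr_ge0 // ltW.
  by apply: exprn_ge0; apply: divr_ge0 => //; exact: ltW kappa1_gt0.
have LL0 : 0 <= L * (1 + ln L) by lra.
apply: (@le_trans _ _ ((m^-1 + 3) * (L * (1 + ln L)) + 8 / m * (L * (1 + ln L)) +
   (m^-1 + 3) * (6 / kappa1) ^+ 6 * (L * (1 + ln L)))).
  by apply: lerD; [apply: lerD|apply: le_trans small _].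
rewrite -!mulrDl -mulrA ler_wpM2r // /C1; lra.
Qed.

Lemma energy_log_decay : exists C X : R, 0 < C /\ forall L, X <= L ->
  E (expR L) <= C * (1 + ln L) * L `^ (- a).
Proof.
have eM0 := expR_gt0 M.
(* 32 e ^ M: rounding gives K >= L T e ^ (- M) / 4 in 8 / K. 2 c + 12: at most 2 T cells, each
   costing c h + 4 h, plus 4 / (h rho) = 4 T h. The last threshold ensures T >= 2 e ^ M, so that
   [j0] is positive. *)
exists (32 * expR M * C1 * (2 * c + 12)), (2 + 8 * M + (2 * expR M) `^ D).
have C10 : 0 < C1.
  have mi : 0 < m^-1 by rewrite invr_gt0.
  have Z0 : 0 < (6 / kappa1) ^+ 6.
    by apply: exprn_gt0; apply: divr_gt0 => //; exact: kappa1_gt0.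
  rewrite /C1; apply: addr_gt0; last by apply: mulr_gt0 => //; lra.
  by rewrite !addr_gt0 ?divr_gt0.
split; first by rewrite !mulr_gt0 //; have := c_gt0; lra.
move=> L XL.
have P0 := powR_ge0 (2 * expR M) D.
have M0 := M_gt0; have D4 := D_ge4; have m0 := m_gt0; have c0 := c_gt0; have s0 := s_gt0.
have L2 : 2 <= L by lra.
have LM : 8 * M <= L by lra.
have LP : (2 * expR M) `^ D <= L by lra.
have L1 : 1 <= L by lra.
have L0 : 0 < L by lra.
have [ln0 lnL] := ln_leid L1.
set T := L `^ D^-1.
have T2M : 2 * expR M <= T.
  have -> : 2 * expR M = ((2 * expR M) `^ D) `^ D^-1.
    by rewrite -powRrM mulfV ?lt0r_neq0 // powRr1 // mulr_ge0 // ltW.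
  by rewrite ge0_ler_powR ?nnegrE ?invr_ge0 ?(ltW D_gt0) ?(ltW L0).
have eM1 : 1 <= expR M by rewrite -expR0 ler_expR ltW.
have T2 : 2 <= T by nra.
have TM2 : 2 <= T * expR (- M) by rewrite expRN ler_pdivlMr.
set j0 := Num.truncn (T * expR (- M)).
have /andP[j1 j2] : j0%:R <= T * expR (- M) < j0.+1%:R by apply: truncn_itv; lra.
have j0h : T * expR (- M) / 2 <= j0%:R by move: j2; rewrite -natr1; lra.
have j00 : (0 < j0)%N by rewrite -(ltr_nat R); lra.
have eMle : expR (- M) <= 1 by rewrite -expR0 ler_expR oppr_le0 ltW.
have j0T : j0%:R <= T by nra.
(* With rho as below, h = rho ^ s = 1 / (T h rho): this balances the Lipschitz
   loss 4 h with the two terms of E_avg, divided by the number of cells. *)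
set h := L `^ (- a).
have h0 : 0 < h by exact: powR_gt0.
have h1 : h <= 1.
  by rewrite /h -[leRHS](powRr0 L) ler_powR // oppr_le0 ltW.
set t := L - e * ln L.
have etE : expR (L - t) = T * h.
  rewrite /t opprB addrC subrK /T /h -powRD; last by rewrite (lt0r_neq0 L0) implybT.
  by rewrite -aeD addrAC subrr add0r /powR gt_eqF.
have etME : expR (L - t - M) = T * expR (- M) * h.
  by rewrite expRD etE; ring.
set N := (Num.truncn T).+1.
have /andP[N1 N2] : (Num.truncn T)%:R <= T < N%:R by apply: truncn_itv; lra.
have NT : N%:R <= 2 * T by rewrite /N -natr1; lra.
have tL : L / 2 <= t.
  have := D_ge4; rewrite /t.
  have : e * ln L <= L / 2; last by lra.
  have e4 : e <= 1 / 2.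
    by rewrite /e ler_pdivrMr // /S; have := D_ge4; nra.
  nra.
have tL' : t <= L by rewrite /t gerBl; apply: mulr_ge0 => //; exact: ltW e_gt0.
have t0 : 0 < t by lra.
set n0 := Num.truncn (t / M).
have /andP[n01 n02] : n0%:R <= t / M < n0.+1%:R by apply: truncn_itv; rewrite divr_ge0 // ltW.
set n1 := Num.truncn (t / m).
have /andP[n11 n12] : n1%:R <= t / m < n1.+1%:R by apply: truncn_itv; rewrite divr_ge0 // ltW.
have := geom_sum_le L2 LM (erefl T) j00 j0T tL tL'.
set K := Num.truncn (L * j0%:R) => gs.
have j01 : 1 <= j0%:R :> R by rewrite ler1n.
have Lj0 : 2 <= L * j0%:R by nra.
have /andP[K1 K2] : K%:R <= L * j0%:R < K.+1%:R by apply: truncn_itv; lra.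
have Kh : L * j0%:R / 2 <= K%:R by move: K2; rewrite -natr1; lra.
have Kpos : (0 < K)%N by rewrite -(ltr_nat R); lra.
(* [truncn] rounds t / m down, so one more step ensures that t is reached; this is the source of
   [n1.+2] in [geom_sum_le]. *)
have main := @walk_energy_bound R I q z E m M q_ge0 q_sum1 M_gt0 zm zM
  E_ge0 E_lip E_sub L t h L^-1 j0 N K n0 n1.+1.
apply: le_trans (main _ _ _ _ _ _ _ _ _ _) _ => //.
- by rewrite etME ler_wpM2r // ltW.
- by rewrite etE ltr_pM2r.
- by rewrite invr_ge0 ltW.
- by rewrite ler_pdivrMr // mulrC.
- by rewrite -ler_pdivlMr.
- by rewrite -ler_pdivrMr // ltW.
set rho := L `^ (- (S * D)^-1).
have rho0 : 0 < rho by exact: powR_gt0.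
have rhos : rho `^ s = h.
  by rewrite /rho -powRrM; congr powR; rewrite /a; field; rewrite !lt0r_neq0.
have hrho : (h * rho)^-1 = T * h.
  rewrite /h /rho /T -!powRD; try by rewrite (lt0r_neq0 L0) implybT.
  rewrite -powRN; congr powR.
  by rewrite /a /S; field; rewrite !lt0r_neq0.
have h01 : 0 < h <= 1 by rewrite h0 h1.
have avg : \sum_(j < N) E (j%:R * h) + N%:R * (4 * h) <= (2 * c + 12) * (T * h).
  apply: le_trans (lerD (E_avg N h01 rho0) (lexx _)) _.
  rewrite rhos hrho.
  have : N%:R * (c * h) <= 2 * T * (c * h) by rewrite ler_wpM2r // mulr_ge0 ?ltW.
  have : N%:R * (4 * h) <= 2 * T * (4 * h) by rewrite ler_wpM2r // mulr_ge0 ?ltW.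
  lra.
have T0 : 0 < T by lra.
have k8 : 8 / K%:R <= 32 * expR M / (L * T).
  have : L * T * expR (- M) / 4 <= K%:R.
    apply: le_trans Kh.
    have -> : L * T * expR (- M) / 4 = L * (T * expR (- M) / 2) / 2 by field.
    by rewrite ler_wpM2r // ler_wpM2l // ltW.
  have KR0 : 0 < K%:R :> R by rewrite ltr0n.
  move=> hK; rewrite ler_pdivrMr //.
  apply: (@le_trans _ _ (32 * expR M / (L * T) * (L * T * expR (- M) / 4))); last first.
    by rewrite ler_wpM2l // divr_ge0 ?mulr_ge0 // ltW.
  rewrite expRN le_eqVlt; apply/orP; left; apply/eqP.
  by field; rewrite !lt0r_neq0.
have nc0 : 0 <= \sum_(d < K) nc (char_geom q z n0 n1.+2 (d%:R * L^-1)).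
  by apply: sumr_ge0 => d _; exact: nc_ge0.
apply: (@le_trans _ _ (32 * expR M / (L * T) * (C1 * L * (1 + ln L)) *
   ((2 * c + 12) * (T * h)))).
  apply: ler_pM => //.
  - by rewrite mulr_ge0 // divr_ge0.
  - by rewrite addr_ge0 ?sumr_ge0 // mulr_ge0 // mulr_ge0 // ltW.
  - by apply: ler_pM => //; rewrite divr_ge0.
rewrite le_eqVlt; apply/orP; left; apply/eqP.
by field; rewrite !lt0r_neq0.
Qed.

End LogDecay.

(** * Moran's equation and the final estimate *)

Lemma finite_pos_bounds (R : realType) (A : finType) (w0 : A) (f : A -> R) :
  (forall w, 0 < f w) ->
  exists m M, [/\ 0 < m, (forall w, m <= f w) & (forall w, f w <= M) /\ exists w, f w = M].
Proof.
move=> f0.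
exists (f [arg min_(w < w0) f w]%O), (f [arg max_(w > w0) f w]%O); split=> //.
- by move=> w; case: arg_minP => // v _ /(_ w isT).
- split; last by eexists.
  by move=> w; case: arg_maxP => // v _ /(_ w isT).
Qed.

(** Intermediate values: the sum is #|A| >= 2 at exponent 0, which also makes s positive, and at
    most 1 at [T], where rM ^ T = 1 / #|A|. *)
Lemma moran_exponent (R : realType) (A : finType) (r : A -> R) (j k : A) :
  j != k -> (forall w, 0 < r w < 1) -> exists2 s : R, 0 < s & \sum_w r w `^ s = 1.
Proof.
move=> jk r01.
have r0 w : 0 < r w by case/andP: (r01 w).
have r1 w : r w < 1 by case/andP: (r01 w).
have [_ [rM [_ _ [rMP [w0 rMw]]]]] := finite_pos_bounds j r0.
have rM0 : 0 < rM by rewrite -rMw.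
have rM1 : rM < 1 by rewrite -rMw.
have cA : 2 <= #|A|%:R :> R.
  rewrite (ler_nat _ 2) (cardD1 j) (cardD1 k) !inE /=.
  by rewrite eq_sym jk.
have lnr : ln rM < 0 by rewrite ln_lt0 // rM0.
pose T := ln #|A|%:R / (- ln rM).
have T0 : 0 <= T by rewrite divr_ge0 ?ln_ge0 ?oppr_ge0 ?(ltW lnr) //; lra.
pose f t := \sum_w r w `^ t.
have fc : {within `[0, T], continuous f}.
  apply: continuous_subspaceT => t; apply: cvg_big => //=.
    exact: add_continuous.
  move=> w _; have powE u : r w `^ u = expR (u * ln (r w)) by rewrite /powR gt_eqF.
  rewrite powE (_ : (fun u => _) = fun u => expR (u * ln (r w))); last exact/funext.
  apply: continuous_cvg; first exact: continuous_expR.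
  by apply: cvgMl; exact: cvg_id.
have f0E : f 0 = #|A|%:R.
  rewrite /f; under eq_bigr do rewrite powRr0.
  by rewrite sumr_const.
have fT : f T <= 1.
  apply: (@le_trans _ _ (\sum_(w : A) rM `^ T)).
    by apply: ler_sum => w _; rewrite ge0_ler_powR ?nnegrE // ltW.
  rewrite sumr_const -[X in X <= _]mulr_natl /powR gt_eqF //.
  have -> : T * ln rM = - ln #|A|%:R.
    by rewrite /T; field; rewrite lt_eqF.
  rewrite expRN lnK ?posrE; last by lra.
  by rewrite mulfV // gt_eqF //; lra.
have [|t t0T ft] := @IVT R f 0 T 1 T0 fc.
  rewrite ge_min le_max fT f0E (_ : 1 <= #|A|%:R) ?orbT //; lra.
exists t => //; have := t0T; rewrite in_itv /= le_eqVlt => /andP[/orP[/eqP t0|//] _].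
by move: ft; rewrite -t0 f0E => h; lra.
Qed.

(** For j = k the ratio is 1, which p = q = 1 approximates exactly. *)
Lemma non_liouville_ln_neq (R : realType) (A : finType) (r : A -> R) (j k : A) (l : R) :
  (forall w, 0 < r w < 1) -> non_liouville l (ln (r j) / ln (r k)) -> j != k.
Proof.
move=> r01 [c c0 hc]; apply/eqP => jk; move: (hc 1 1%N isT).
have lnr : ln (r k) < 0 by rewrite ln_lt0.
rewrite jk divff ?lt_eqF // powR1 !divr1 subrr normr0 => h.
by have := lt_le_trans c0 h; rewrite ltxx.
Qed.

(** ln L = ln (L ^ g) / g <= L ^ g / g with g = a - a'. *)
Lemma log_absorb (R : realType) (a a' L : R) : 0 < a' -> a' < a -> 1 <= L ->
  (1 + ln L) * L `^ (- a) <= (1 + (a - a')^-1) * L `^ (- a').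
Proof.
move=> a'0 aa L1.
have L0 : 0 < L by lra.
have g0 : 0 < a - a' by rewrite subr_gt0.
have Lg : 1 <= L `^ (a - a').
  by rewrite -[leLHS](powRr0 L) ler_powR // ltW.
have lnLg : ln L <= (a - a')^-1 * L `^ (a - a').
  rewrite ler_pdivlMl // -ln_powR.
  have h : ln (1 + (L `^ (a - a') - 1)) <= L `^ (a - a') - 1 by apply: le_ln1Dx; lra.
  by rewrite (_ : 1 + (L `^ (a - a') - 1) = L `^ (a - a')) in h; [lra|ring].
have -> : L `^ (- a') = L `^ (a - a') * L `^ (- a).
  by rewrite -powRD ?(gt_eqF L0) ?implybT //; congr powR; ring.
rewrite mulrA ler_wpM2r ?powR_ge0 //; lra.
Qed.

Lemma normc_fourier (R : realType) (F : set R) (mu : probability (measurableTypeR R) R) xi :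
  measurable (F : set (measurableTypeR R)) -> mu F = 1%E ->
  `|fourier F mu xi| = (Num.sqrt (energy mu (2 * pi * xi)))%:C%C.
Proof.
move=> mF muF; rewrite normc_def /fourier /= sqrrN.
by rewrite (Rintegral_full mF muF (bdd_cos0 _)) (Rintegral_full mF muF (bdd_sin0 _)).
Qed.

Section FourierDecay.
Context (R : realType) (A : finType) (r b : A -> R).
Hypothesis r01 : forall w, 0 < r w < 1.
Hypothesis b_ge0 : forall w, 0 <= b w.
Hypothesis br_le1 : forall w, b w + r w <= 1.
Hypothesis disj : forall w w', w != w' ->
  `]b w, b w + r w[%classic `&` `]b w', b w' + r w'[%classic = set0.

Lemma natural_measure_energy_decay (j k : A) (l s : R) : 2 <= l -> 0 < s ->
  \sum_w r w `^ s = 1 -> non_liouville l (ln (r j) / ln (r k)) ->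
  exists mu : probability (measurableTypeR R) R,
  [/\ forall B : set (measurableTypeR R), measurable B ->
          mu B = (\sum_w (r w `^ s)%:E *
            pushforward mu (similitude (r w) (b w) :
              measurableTypeR R -> measurableTypeR R) B)%E,
      mu (`[0, 1]%classic : set R) = 1%E &
      exists C X : R, 0 < C /\ forall L, X <= L ->
        energy mu (expR L) <=
        C * (1 + ln L) * L `^ (- (s / ((1 + 2 * s) * (4 * (l - 1)))))].
Proof.
move=> l2 s0 moran hjk.
have r0 w : 0 < r w by case/andP: (r01 w).
have r1 w : r w < 1 by case/andP: (r01 w).
have [rm [rM [rm0 rmP [rMP [w0 rMw]]]]] := finite_pos_bounds j r0.
have rM1 : rM < 1 by rewrite -rMw.
have rmM : rm <= rM by apply: le_trans (rmP j) (rMP j).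
have [mu [mu_ss mu01 [c c0 ball]]] :=
  natural_measure s0 rm0 rM1 rmP rMP rmM b_ge0 br_le1 disj moran.
exists mu; split => //.
pose x w := - ln (r w).
pose p w := r w `^ s.
have x0 w : 0 < x w by rewrite oppr_gt0 ln_lt0.
have p0 w : 0 < p w by exact: powR_gt0.
have p0' w : 0 <= p w by exact: ltW.
have [m [M [m0 mP [MP _]]]] := finite_pos_bounds j x0.
have M0 : 0 < M by apply: lt_le_trans (x0 j) (MP j).
have hx : non_liouville l (x j / x k).
  by rewrite /x invrN mulrNN.
have l1 : 1 <= l by lra.
have M20 : 0 < 2 * M by rewrite mulr_gt0.
have iM : 0 < (2 * M)^-1 by rewrite invr_gt0.
have [kappa k0 hk] := dbl_char_decay p0 moran x0 l1 iM hx.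
(* A doubled step reaches 2 M, so theta0 = 1 / (2 M) is where the drift bound stops and the
   Diophantine one must start. *)
apply: (@energy_log_decay R _ (dbl_weight p) (dbl_length x) (energy mu) m (2 * M)
  _ _ m0 M20 _ _ (energy_ge0 mu) (energy_lip mu01) _ c s l kappa) => //.
- exact: dbl_weight_ge0.
- exact: dbl_weight_sum1.
- case=> [w|[w v]] /=; first exact: mP.
  by have := mP w; have := x0 v; lra.
- case=> [w|[w v]] /=; first by have := MP w; lra.
  by have := MP w; have := MP v; lra.
- move=> u; apply: dbl_subharmonic => // {}u.
  apply: le_trans (energy_self_similar u p0' moran mu_ss) _.
  by apply: ler_sum => w _; rewrite /x opprK lnK ?posrE // (mulrC u).
- move=> h rho N h01 rho0; apply: (energy_average mu01) => // y.
  exact: ball.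
Qed.

End FourierDecay.

Theorem theorem3 (R : realType) (A : finType) (r b : A -> R) (F : set R)
    (r01 : forall w, 0 < r w < 1) (b01 : forall w, 0 <= b w <= 1)
    (f01 : forall (w : A) (x : R), 0 <= x <= 1 ->
      0 <= similitude (r w) (b w) x <= 1)
    (F_self_similar : self_similar_set (fun w => similitude (r w) (b w)) F)
    (f_disjoint : forall w w' : A, w != w' ->
      (similitude (r w) (b w) @` `[0, 1])^° `&`
      (similitude (r w') (b w') @` `[0, 1])^° = set0)
    (j k : A) (l : R) (l_ge2 : 2 <= l)
    (hjk : non_liouville l (ln (r j) / ln (r k))) :
  exists mu : probability (measurableTypeR R) R,
    [/\ self_similar_measure (fun w => similitude (r w) (b w)) mu,
        mu F = 1%E &
        let rate (xi : R) : R :=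
          (ln `|xi|) `^
            (- (hausdorff_dim F
                / (2 * (1 + 2 * hausdorff_dim F) * (8 * l - 7)))) in
        let mu_hat : R -> R[i]^o := fourier F mu in
        let rateC : R -> R[i]^o := fun xi => (rate xi)%:C%C in
        mu_hat =O_ (pinfty_nbhs R) rateC /\ mu_hat =O_ (ninfty_nbhs R) rateC].
Proof.
have r0 w : 0 < r w by case/andP: (r01 w).
have b0 w : 0 <= b w by case/andP: (b01 w).
have br1 w : b w + r w <= 1.
  have /andP[_] := f01 w 1 (introT andP (conj ler01 (lexx 1))).
  by rewrite /similitude mulr1 addrC.
have sub_int w : `]b w, b w + r w[%classic `<=` (similitude (r w) (b w) @` `[0, 1])^°.
  rewrite -open_subsetE; last exact: interval_open.
  move=> y /=; rewrite in_itv /= => /andP[y1 y2].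
  exists ((y - b w) / r w); last first.
    by rewrite /similitude mulrC divfK ?subrK // lt0r_neq0.
  rewrite /= in_itv /= divr_ge0 ?subr_ge0 ?(ltW y1) ?(ltW (r0 w)) //=.
  by rewrite ler_pdivrMr // mul1r; lra.
have disj w w' : w != w' ->
    `]b w, b w + r w[%classic `&` `]b w', b w' + r w'[%classic = set0.
  move=> ww'; rewrite -subset0 => y [/sub_int h1 /sub_int h2].
  by have := f_disjoint _ _ ww'; rewrite -subset0 => /(_ y); apply.
have jk := non_liouville_ln_neq r01 hjk.
have [s s0 moran] := moran_exponent jk r01.
have [mu [mu_ss mu01 [C [X [C0 decay]]]]] :=
  natural_measure_energy_decay r01 b0 br1 disj l_ge2 s0 moran hjk.
have [_ [rM [_ _ [rMP [w0 rMw]]]]] := finite_pos_bounds j r0.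
have rM1 : rM < 1 by rewrite -rMw; case/andP: (r01 w0).
have rM0 : 0 < rM by rewrite -rMw.
have muF := self_similar_measure_full r0 rMP rM1 rM0 F_self_similar mu_ss mu01.
have /andP[d0 ds] := hausdorff_dim_le r0 rMP rM1 rM0 F_self_similar moran (ltW s0).
have mF : measurable (F : set (measurableTypeR R)).
  apply: closed_measurable; apply: compact_closed => //.
  by case: F_self_similar.
exists mu; split => //.
  by exists (fun w => r w `^ s); split => // w; exact: powR_gt0.
set d := hausdorff_dim F in d0 ds *.
set alpha := d / _.
pose a := s / ((1 + 2 * s) * (4 * (l - 1))).
pose a' := s / ((1 + 2 * s) * (8 * l - 7)).
have l0 : 0 < l - 1 by lra.
have l1 : 0 < 4 * (l - 1) by lra.
have l7 : 0 < 8 * l - 7 by lra.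
have s12 : 0 < 1 + 2 * s by lra.
have d12 : 0 < 1 + 2 * d by lra.
have a'0 : 0 < a' by rewrite divr_gt0 // mulr_gt0.
have a'a : a' < a.
  rewrite /a' /a ltr_pM2l // ltf_pV2 ?posrE ?mulr_gt0 //.
  by rewrite ltr_pM2l //; lra.
(* The factor 2 accounts for the squared modulus; d <= s is used through the monotonicity of u / (1
   + 2 u). *)
have alpha_le : 2 * alpha <= a'.
  have -> : 2 * alpha = d / (1 + 2 * d) / (8 * l - 7).
    by rewrite /alpha; field; rewrite !lt0r_neq0.
  have -> : a' = s / (1 + 2 * s) / (8 * l - 7).
    by rewrite /a'; field; rewrite !lt0r_neq0.
  rewrite ler_wpM2r ?invr_ge0 ?(ltW l7) //.
  by rewrite ler_pdivlMr // mulrAC ler_pdivrMr //; nra.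
pose C2 := C * (1 + (a - a')^-1).
have g0 : 0 < (a - a')^-1 by rewrite invr_gt0 subr_gt0.
have C20 : 0 < C2 by apply: mulr_gt0 => //; apply: addr_gt0.
have pi2 : 1 <= 2 * pi :> R by have := @pi_ge2 R; lra.
have bound (xi : R) : expR (Num.max 1 X) <= xi ->
    Num.sqrt (energy mu (2 * pi * xi)) <= Num.sqrt C2 * (ln xi) `^ (- alpha).
  move=> xiX.
  have xi0 : 0 < xi by apply: lt_le_trans xiX; exact: expR_gt0.
  have pxi0 : 0 < 2 * pi * xi by rewrite mulr_gt0 // (lt_le_trans ltr01).
  (* [energy] takes the frequency 2 pi xi, so L exceeds ln xi; the power being nonincreasing, it may
     be taken at ln xi. *)
  pose L := ln (2 * pi * xi).
  have lx : Num.max 1 X <= ln xi by rewrite -ler_expR lnK ?posrE.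
  have lxL : ln xi <= L.
    by rewrite ler_ln ?posrE // ler_peMl // ltW.
  have [lx1 lxX] : 1 <= ln xi /\ X <= ln xi by move: lx; rewrite ge_max => /andP.
  have L1 : 1 <= L by apply: le_trans lxL.
  have EL : energy mu (2 * pi * xi) <= C2 * (ln xi) `^ (- (2 * alpha)).
    have -> : 2 * pi * xi = expR L by rewrite lnK ?posrE.
    apply: le_trans (decay L (le_trans lxX lxL)) _.
    rewrite -mulrA /C2 -[leRHS]mulrA ler_wpM2l ?(ltW C0) //.
    apply: le_trans (log_absorb a'0 a'a L1) _.
    apply: ler_wpM2l; first by rewrite addr_ge0 // invr_ge0 subr_ge0 ltW.
    apply: (@le_trans _ _ (L `^ (- (2 * alpha)))).
      by rewrite ler_powR // lerN2.
    have al0 : 0 <= 2 * alpha by rewrite mulr_ge0 // divr_ge0 // !mulr_ge0 // ltW.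
    rewrite !powRN lef_pV2 ?posrE ?powR_gt0 //; try lra.
    by rewrite ge0_ler_powR ?nnegrE //; lra.
  apply: le_trans (ler_wsqrtr EL) _.
  rewrite sqrtrM ?(ltW C20) //.
  have -> : ln xi `^ (- (2 * alpha)) = (ln xi `^ (- alpha)) ^+ 2.
    by rewrite -powR_mulrn ?powR_ge0 // -powRrM; congr powR; ring.
  by rewrite sqrtr_sqr ger0_norm ?powR_ge0.
have sC2 : 0 < (Num.sqrt C2)%:C%C :> R[i] by rewrite ltcR sqrtr_gt0.
move=> rate mu_hat rateC.
have normE xi : expR (Num.max 1 X) <= `|xi| ->
    `|mu_hat xi| <= (Num.sqrt C2)%:C%C * `|rateC xi|.
  move=> xiX; rewrite /mu_hat normc_fourier //.
  have -> : `|rateC xi| = (rate xi)%:C%C.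
    by rewrite normc_def /= expr0n addr0 sqrtr_sqr ger0_norm ?powR_ge0.
  rewrite -rmorphM lecR; apply: le_trans (bound _ xiX).
  have [xi0|xi0] := ger0P xi; first by [].
  by rewrite mulrN energy_even.
split; apply/eqO_exP; exists (Num.sqrt C2)%:C%C => //.
  near=> xi; apply: normE; apply: le_trans (ler_norm _).
  by near: xi; exact: nbhs_pinfty_ge.
near=> xi; apply: normE; rewrite -normrN; apply: le_trans (ler_norm _).
by rewrite lerNr; near: xi; exact: nbhs_ninfty_le.
Unshelve. all: by end_near. Qed.
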